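(* Let $L$ be a compact metric space and let $K$ be a compact zero-dimensional space. Then the following assertions are equivalent: \begin{enumerate} \item[(i)] $C(K)$ contains an isometric copy of $C(L)$; \item[(ii)] there exists a closed subset of $K$ which maps continuously onto $L$; \item[(iii)] $|L^{(\alpha)}|\le |K^{(\alpha)}|$ for each ordinal $\alpha$; \item[(iv)] if $L$ is nonscattered, then $K$ is nonscattered, and if $L$ is scattered, then $|L^{(ht(L)-1)}|\le |K^{(ht(L)-1)}|$; \item[(v)] $C(K)$ contains a positive isometric copy of $C(L)$; \item[(vi)] there is an isomorphic embedding $T\colon C(L)\to C(K)$ with $\|T\|\,\|T^{-1}\|<3$; \item[(vii)] for each Banach space $E$, $C(K,E)$ contains an isometric copy of $C(L)$; \item[(viii)] there exists a strictly convex Banach space $E$ such that $C(K,E)$ contains an isometric copy of $C(L)$; \item[(ix)] $K$ maps continuously onto $L$; \item[(x)] there exists an isometric embedding of $C(L)$ into $C(K)$ which is also an embedding in the sense of Banach lattices and Banach algebras. \end{enumerate}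
   Context: All compact spaces are Hausdorff. A space is zero-dimensional if it has a base of clopen sets. All Banach spaces are real and of dimension at least one, so the compact spaces considered here are nonempty. For a Banach space $E$, $C(K,E)$ is the Banach space of continuous $E$-valued functions on $K$ with the supremum norm, and $C(K)=C(K,\mathbb R)$, which is also a Banach lattice and Banach algebra with pointwise operations. Embeddings of Banach spaces are linear: an isomorphic embedding is a bounded linear operator that is an isomorphism onto its image, and $T^{-1}$ is the inverse defined on the image; an isometric embedding is a linear norm-preserving map. A space $F$ contains an isometric copy of $C(L)$ if there is an isometric embedding $C(L)\to F$; $C(K)$ contains a positive isometric copy of $C(L)$ if there is an isometric embedding $T\colon C(L)\to C(K)$ with $T(f)\ge 0$ whenever $f\ge0$. In (x), the embedding additionally preserves the lattice operations and multiplication. Cantor--Bendixson derivatives: for a topological space $S$, $S^{(0)}=S$, $S^{(1)}$ is the set of accumulation points of $S$, $S^{(\alpha)}=(S^{(\beta)})^{(1)}$ for $\alpha=\beta+1$, and $S^{(\alpha)}=\bigcap_{\beta<\alpha}S^{(\beta)}$ for limit $\alpha$. The perfect kernel $S^{(\infty)}$ is the eventual constant value of $S^{(\alpha)}$. $S$ is scattered if $S^{(\infty)}=\emptyset$, and then $ht(S)$ is the least ordinal $\alpha$ with $S^{(\alpha)}=\emptyset$ (for a nonempty scattered compact space it is a successor ordinal, and $ht(S)-1$ is its predecessor). *)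

(* Defs.v *)
From HB Require Import structures.
From mathcomp Require Import all_boot all_order all_algebra.
From mathcomp Require Import all_classical all_reals.
From mathcomp Require Import topology normedtype.
From mathcomp Require Import ring lra.

Set Implicit Arguments.
Unset Strict Implicit.
Unset Printing Implicit Defensive.

Import Order.TTheory GRing.Theory Num.Theory.
Import numFieldNormedType.Exports.

Local Open Scope classical_set_scope.
Local Open Scope ring_scope.

(* Ordinals as classical Brouwer trees: [osup f] denotes the supremum of the
   ordinals denoted by the [f i]. Every ordinal is denoted by a tree; distinct
   trees may denote the same ordinal, which [ole] identifies. *)
Inductive ord : Type :=
  | ozero
  | osucc of ord
  | osup (I : Type) of (I -> ord).

(* a + 1 <= b + 1 iff a <= b, and a + 1 <= sup_j g j iff a + 1 <= g j for
   some j. *)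
Fixpoint ole (a : ord) : ord -> Prop :=
  match a with
  | ozero => fun=> True
  | osucc a' => fix osucc_le (b : ord) : Prop :=
      match b with
      | ozero => False
      | osucc b' => ole a' b'
      | osup _ g => exists j, osucc_le (g j)
      end
  | osup _ f => fun b => forall i, ole (f i) b
  end.

Definition olt (a b : ord) := ole (osucc a) b.

Definition olimit (a : ord) :=
  olt ozero a /\ forall b, olt b a -> olt (osucc b) a.

Lemma ole_sup a I (g : I -> ord) j : ole a (g j) -> ole a (osup g).
Proof.
by elim: a => [|a _|J f IH] //= H; [exists j | move=> i; exact/IH/H].
Qed.

Lemma ole_refl a : ole a a.
Proof. by elim: a => [|a IH|I f IH] //= i; exact: (ole_sup (IH i)). Qed.

Section CantorBendixson.
Context {S : topologicalType}.

(* The accumulation points of the subspace A. *)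
Definition derived_set (A : set S) := A `&` limit_point A.

Fixpoint CBderiv (a : ord) : set S :=
  match a with
  | ozero => [set: S]
  | osucc b => derived_set (CBderiv b)
  | osup _ f => [set x | forall i, CBderiv (f i) x]
  end.

Lemma CBderiv_anti a b : ole a b -> CBderiv b `<=` CBderiv a.
Proof.
elim: a b => [|a IHa|I f IH] b //=; last first.
  by move=> H x bx i; exact: (IH i b (H i)).
elim: b => [//|b _ ab x [bx lx]|J g IH [j /IH{}IH] x gx]; last exact: IH (gx j).
split; first exact: IHa bx.
by move=> U /lx[y [yx yb yU]]; exists y; split => //; exact: IHa yb.
Qed.

(* Not stated with [\bigcap_(b in _)]: a [set ord] would force the universe of
   [ord] strictly below that of [S], which [perfect_kernel_ex] excludes. *)
Lemma CBderiv_limit a x :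
  olimit a -> CBderiv a x <-> forall b, olt b a -> CBderiv b x.
Proof.
move=> [_ lima]; split=> [ax b ba|Hx].
  by case: (CBderiv_anti ba ax).
have {Hx lima} : forall b, olt b a -> CBderiv (osucc b) x.
  by move=> b ba; exact/Hx/lima.
elim: a => [//|a _ H|I f IH H i]; first exact/H/ole_refl.
by apply: IH => b bf; apply: H; exists i.
Qed.

Definition is_perfect_kernel (P : set S) :=
  exists a, forall b, ole a b -> CBderiv b = P.

Lemma perfect_kernel_ex : exists P, is_perfect_kernel P.
Proof.
have /choice[f fP] (x : S) :
    exists a, (exists b, ~ CBderiv b x) -> ~ CBderiv a x.
  have [[b Hb]|H] := pselect (exists b, ~ CBderiv b x); first by exists b.
  by exists ozero.
exists [set x | forall a, CBderiv a x], (osup f) => b fb.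
apply/seteqP; split=> x /= Hx; last exact: Hx.
move=> a; apply: contrapT => nax.
by have /fP := ex_intro (fun b => ~ CBderiv b x) a nax; apply;
  exact: (CBderiv_anti (fb x)).
Qed.

End CantorBendixson.
Arguments CBderiv : clear implicits.

Definition scattered (S : topologicalType) := is_perfect_kernel (@set0 S).

Definition is_height (S : topologicalType) (a : ord) :=
  CBderiv S a = set0 /\ forall b, CBderiv S b = set0 -> ole a b.

(* The library's [zero_dimensional] only asks that clopen sets separate points,
   which is weaker for general spaces. *)
Definition clopen_based (S : topologicalType) :=
  exists2 B : set (set S), B `<=` clopen & basis B.

(* The Banach space C(K, E). The compactness of K is a parameter of the type,
   as the supremum norm depends on it. *)
Definition Cont (R : realType) (K : topologicalType)
    (hK : compact [set: K]) (E : normedModType R) :=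
  continuousType K E.

Section Cont.
Context {R : realType} {K : topologicalType} {hK : compact [set: K]}.

Section vector_space.
Context {E : normedModType R}.
Local Notation C := (@Cont R K hK E).
Implicit Types f g h : C.

HB.instance Definition _ := Choice.on C.

Lemma Cont_continuous f : continuous (f : K -> E).
Proof. exact: cts_fun. Qed.

Definition mkCont (f : K -> E) (cf : continuous f) : C := mkcts cf.

Lemma ContP f g : (forall x, f x = g x) -> f = g.
Proof. by move=> H; exact/continuousEP. Qed.

Fact Cont0_cont : continuous ((fun=> 0) : K -> E).
Proof. by move=> x; exact: cvg_cst. Qed.
Definition Cont0 : C := mkCont Cont0_cont.

Fact ContN_cont f : continuous (fun x => - f x).
Proof. by move=> x; apply: cvgN; exact: Cont_continuous. Qed.
Definition ContN f : C := mkCont (@ContN_cont f).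

Fact ContD_cont f g : continuous (fun x => f x + g x).
Proof. by move=> x; apply: cvgD; exact: Cont_continuous. Qed.
Definition ContD f g : C := mkCont (@ContD_cont f g).

Fact ContZ_cont (k : R) f : continuous (fun x => k *: f x).
Proof. by move=> x; apply: cvgZr; exact: Cont_continuous. Qed.
Definition ContZ (k : R) f : C := mkCont (@ContZ_cont k f).

Fact ContDA : associative ContD.
Proof. by move=> f g h; apply: ContP => x; exact: addrA. Qed.
Fact ContDC : commutative ContD.
Proof. by move=> f g; apply: ContP => x; exact: addrC. Qed.
Fact ContD0 : left_id Cont0 ContD.
Proof. by move=> f; apply: ContP => x; exact: add0r. Qed.
Fact ContDN : left_inverse Cont0 ContN ContD.
Proof. by move=> f; apply: ContP => x; exact: addNr. Qed.

HB.instance Definition _ := GRing.isZmodule.Build C ContDA ContDC ContD0 ContDN.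

Fact ContZA (a b : R) f : ContZ a (ContZ b f) = ContZ (a * b) f.
Proof. by apply: ContP => x; exact: scalerA. Qed.
Fact ContZ1 : left_id 1 ContZ.
Proof. by move=> f; apply: ContP => x; exact: scale1r. Qed.
Fact ContZDr : right_distributive ContZ +%R.
Proof. by move=> a f g; apply: ContP => x; exact: scalerDr. Qed.
Fact ContZDl f : {morph ContZ^~ f : a b / a + b}.
Proof. by move=> a b; apply: ContP => x; exact: scalerDl. Qed.

HB.instance Definition _ :=
  GRing.Zmodule_isLmodule.Build R C ContZA ContZ1 ContZDr ContZDl.

Definition supnorm f : R := sup (range (fun x => `|f x|)).

Lemma supnorm_has_ubound f : has_ubound (range (fun x => `|f x|)).
Proof.
have cf : continuous (fun x => `|f x|).
  move=> x; apply: (@continuous_comp K E R f Num.norm).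
    exact: Cont_continuous.
  exact: norm_continuous.
have /compact_bounded[M [_ HM]] :=
  continuous_compact (continuous_subspaceT cf) hK.
exists (M + 1) => _ [x _ <-].
have := HM (M + 1); rewrite ltrDl ltr01 => /(_ isT `|f x|) /=.
by rewrite normr_id; apply; exists x.
Qed.

Lemma ler_supnorm f x : `|f x| <= supnorm f.
Proof. by apply: ub_le_sup; [exact: supnorm_has_ubound | exists x]. Qed.

Lemma supnorm_le f M : 0 <= M -> (forall x, `|f x| <= M) -> supnorm f <= M.
Proof.
move=> M0 fM; rewrite /supnorm.
have [->|/set0P ne] := eqVneq (range (fun x => `|f x|)) set0.
  by rewrite sup0.
by apply: ge_sup => // _ [x _ <-].
Qed.

Lemma supnorm_ge0 f : 0 <= supnorm f.
Proof.
rewrite /supnorm.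
have [->|/set0P[_ [x _ _]]] := eqVneq (range (fun x => `|f x|)) set0.
  by rewrite sup0.
exact: le_trans (ler_supnorm f x).
Qed.

Fact supnormD f g : supnorm (f + g) <= supnorm f + supnorm g.
Proof.
apply: supnorm_le => [|x]; first by rewrite addr_ge0 ?supnorm_ge0.
by rewrite (le_trans (ler_normD _ _))// lerD ?ler_supnorm.
Qed.

Fact supnormZ_le (k : R) f : supnorm (k *: f) <= `|k| * supnorm f.
Proof.
apply: supnorm_le => [|x]; first by rewrite mulr_ge0 ?supnorm_ge0.
by rewrite [X in `|X|]/(k *: f x) normrZ ler_wpM2l ?ler_supnorm.
Qed.

Fact supnormZ (k : R) f : supnorm (k *: f) = `|k| * supnorm f.
Proof.
apply/eqP; rewrite eq_le supnormZ_le/=.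
have [->|k0] := eqVneq k 0; first by rewrite normr0 mul0r supnorm_ge0.
rewrite -{1}[f]scale1r -(mulVf k0) -scalerA.
rewrite -ler_pdivlMl ?normr_gt0// -normfV; exact: supnormZ_le.
Qed.

Fact supnorm0_eq0 f : supnorm f = 0 -> f = 0.
Proof.
move=> f0; apply: ContP => x; apply/normr0_eq0/eqP.
by rewrite eq_le normr_ge0 andbT -f0 ler_supnorm.
Qed.

HB.instance Definition _ :=
  Lmodule_isNormed.Build R C supnormD supnormZ supnorm0_eq0.

Lemma Cont_normE f : `|f| = sup (range (fun x => `|f x|)).
Proof. by []. Qed.

End vector_space.

Section completeness.
Context {E : completeNormedModType R}.
Local Notation C := (@Cont R K hK E).

Fact Cont_complete (F : set_system C) : ProperFilter F -> cauchy F -> cvg F.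
Proof.
move=> FF /cauchy_ballP Fc.
have near_pt e : 0 < e -> exists2 A, F A &
    forall f g x, A f -> A g -> `|(f : C) x - (g : C) x| < e.
  move=> e0; have [[A B] [FA FB] AB] := Fc _ e0.
  exists (A `&` B); first exact: filterI.
  move=> f g x [Af _] [_ Bg]; have := AB (f, g) (conj Af Bg).
  rewrite -ball_normE /= => fg; apply: le_lt_trans fg.
  exact: (ler_supnorm (f - g) x).
have cvx x : cvg ((fun f : C => f x) @ F).
  apply: cauchy_cvg; apply/cauchy_ballP => e e0.
  have [A FA HA] := near_pt e e0.
  exists ((fun f : C => f x) @` A, (fun f : C => f x) @` A) => /=.
    have Fim : F ((fun f : C => f x) @^-1` ((fun f : C => f x) @` A)).
      by apply: filterS FA => f Af; exists f.
    by split.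
  move=> [_ _] [[f Af <-] [g Ag <-]].
  by rewrite -ball_normE /=; exact: HA.
pose g x : E := lim ((fun f : C => f x) @ F).
have unif e : 0 < e -> exists2 A, F A &
    forall f x, A f -> `|g x - (f : C) x| <= e.
  move=> e0; have [A FA HA] := near_pt e e0.
  exists A => // f x Af; apply/ler_addgt0Pr => d d0.
  have /cvgrPdist_lt /(_ _ d0) gd : (fun f : C => f x) @ F --> g x := cvx x.
  have [h [gh Ah]] := filter_ex (filterI gd FA).
  rewrite (le_trans (ler_distD (h x) _ _))// addrC lerD ?(ltW gh)//.
  exact/ltW/HA.
have cg : continuous g.
  move=> x; apply/cvgrPdist_lt => e e0.
  have e3 : 0 < e / 3 by rewrite divr_gt0.
  have [A FA HA] := unif _ e3; have [f Af] := filter_ex FA.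
  have /cvgrPdist_lt /(_ _ e3) : f y @[y --> x] --> f x.
    exact: Cont_continuous.
  apply: filterS => y fxy.
  rewrite (le_lt_trans (ler_distD (f x) _ _))//.
  have -> : e = e / 3 + (e / 3 + e / 3) by field.
  rewrite ler_ltD ?HA// (le_lt_trans (ler_distD (f y) _ _))//.
  by rewrite ltr_leD// distrC HA.
apply/cvg_ex; exists (mkCont cg : C); apply/cvgrPdist_le => e e0.
have [A FA HA] := unif _ e0; apply: filterS FA => f Af.
by apply: supnorm_le => [|x]; [exact: ltW | exact: HA].
Qed.

HB.instance Definition _ := Uniform_isComplete.Build C Cont_complete.

End completeness.

Section lattice_algebra.
Local Notation C := (@Cont R K hK R).
Implicit Types f g : C.

Fact Cont_mul_cont f g : continuous (fun x => f x * g x).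
Proof. by move=> x; apply: cvgM; exact: Cont_continuous. Qed.
Definition Cont_mul f g : C := mkCont (@Cont_mul_cont f g).

Fact Cont_max_cont f g : continuous (fun x => Num.max (f x) (g x)).
Proof. by move=> x; apply: continuous_max; exact: Cont_continuous. Qed.
Definition Cont_max f g : C := mkCont (@Cont_max_cont f g).

Fact Cont_min_cont f g : continuous (fun x => Num.min (f x) (g x)).
Proof. by move=> x; apply: continuous_min; exact: Cont_continuous. Qed.
Definition Cont_min f g : C := mkCont (@Cont_min_cont f g).

End lattice_algebra.
End Cont.

Definition isometric (R : realType) (X Y : normedModType R) (T : X -> Y) :=
  forall u, `|T u| = `|u|.

Section bounded_operators.
Context {R : realType} {X Y : normedModType R}.

Definition bounded_on (V : set X) (T : X -> Y) :=
  exists M : R, forall v, V v -> `|T v| <= M * `|v|.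

(* The operator norm of the restriction of T to V. *)
Definition opnorm (V : set X) (T : X -> Y) : R :=
  sup [set `|T v| | v in V `&` [set v | `|v| <= 1]].

End bounded_operators.

Definition strictly_convex (R : realType) (E : normedModType R) :=
  forall u v : E, `|u| = 1 -> `|v| = 1 -> u != v -> `|u + v| < 2.

(* Main.v *)
Require Import Defs.
From HB Require Import structures.
From mathcomp Require Import all_boot all_order all_algebra.
From mathcomp Require Import all_classical all_reals.
From mathcomp Require Import topology normedtype.
From mathcomp Require Import cantor derive.
From mathcomp Require Import lra.

Set Implicit Arguments.
Unset Strict Implicit.
Unset Printing Implicit Defensive.

Import Order.TTheory GRing.Theory Num.Theory.
Import numFieldNormedType.Exports.

Local Open Scope classical_set_scope.
Local Open Scope card_scope.
Local Open Scope ring_scope.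

(** (iii) or (iv) gives (ix).  If the perfect kernel of K is nonempty, splitting
    it repeatedly by clopen sets maps K onto the Cantor space, hence onto L.
    Otherwise L is scattered and one argues by induction on the rank: if the
    closed set A meets L^(b) at most in q, write A \ {q} as a union of closed
    annuli A_k shrinking to q; around a point of K^(b) there are disjoint clopen
    sets W_k mapping onto the A_k by induction, and everything else is sent to q.
    The A_k may overlap, so L need not be zero-dimensional.

    (vi) gives (iv).  Normalise to |f| <= |T f| <= M |f| with M < 3 and put
    eta = (3 - M) / 2.  Let |f| <= 1, f = 1 on U, and let e be a bump in U.  Since
    |f + 2 e| may be 3 while |f - 2 e| <= 1, a point x where T (f + 2 e) is at
    least 3 in absolute value has |T f x| >= eta.  The closure of the set of these
    points x meets K^(a) whenever U meets L^(a).  At a successor step, otherwise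
    only finitely many such points of K^(a) are available; comparing f + 2 e with
    f - 2 g + 2 e for disjoint bumps g = 1 near the support of e gives
    |T g x| >= eta at one of them for arbitrarily many disjoint g, which
    contradicts the boundedness of T.  So if L^(a) had more points than K^(a), a
    linear combination of disjoint bumps at these points would be mapped to a
    function vanishing on K^(a), a contradiction.

    (viii) gives (iii) as in Holsztynski's theorem: the pairs (x, y) such that
    |T f x| = 1 for all f in the unit ball with f y = 1 form a closed relation,
    and by strict convexity each x is related to at most one y. *)

(** * Ordinals and Cantor-Bendixson derivatives *)

Lemma ole_total a b : ole a b \/ olt b a.
Proof.
elim: a b => [|a IHa|I f IH] b; first by left.
  elim: b => [|b _|J g IHb]; first by right.
    by case: (IHa b); [left|right].
  have [[j gj]|H] := pselect (exists j, ole (osucc a) (g j)).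
    by left; exact: (ole_sup gj).
  by right=> j; have [gj|//] := IHb j; case: H; exists j.
have [H|/existsNP[i fi]] := pselect (forall i, ole (f i) b); first by left.
by right; case: (IH i b) => // H; exact: (ole_sup H).
Qed.

Section compactness.
Context {S : topologicalType}.
Implicit Types (A B : set S) (a : ord).

(** If [P] failed for [A], the complements in [A] of the sets on whose trace [P] holds would
    generate a proper filter, and no point of [A] could be a cluster point of it. *)
Lemma compact_ind A (P : set S -> Prop) :
  compact A -> P set0 -> (forall X Y, P X -> P Y -> P (X `|` Y)) ->
  (forall x, A x -> exists2 X, nbhs x X & P (A `&` X)) -> P A.
Proof.
move=> cA P0 PU PA; apply: contrapT => nPA.
pose F := [set B | exists2 X, P (A `&` X) & A `\` X `<=` B].
have FF : ProperFilter F.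
  split.
    move=> [X PX AX0]; apply: nPA; rewrite (_ : A = A `&` X)//.
    apply/seteqP; split=> [x Ax|x []//]; split=> //.
    by apply: contrapT => nXx; exact: (AX0 x).
  split.
  - by exists set0 => //; rewrite setI0.
  - move=> B C [X PX XB] [Y PY YC]; exists (X `|` Y).
      by rewrite setIUr; exact: PU.
    move=> x [Ax /not_orP[nX nY]].
    by split; [exact: XB | exact: YC].
  - by move=> B C BC [X PX XB]; exists X => //; exact: subset_trans XB BC.
have FA : F A by exists set0; [rewrite setI0 | rewrite setD0].
have [x [Ax clx]] := cA F FF FA.
have [X xX PX] := PA x Ax.
have FX : F (A `\` X) by exists X.
by have [z [[_ nXz] Xz]] := clx _ _ FX xX.
Qed.

Lemma derived_set_closed A : closed A -> closed (derived_set A).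
Proof.
move=> cA x clx; have Ax : A x.
  by apply: cA => U /clx[y [[Ay _] Uy]]; exists y.
split=> // U xU; rewrite nbhsE in xU; case: xU => V [oV Vx] VU.
have [y [[Ay ly] Vy]] := clx V (open_nbhs_nbhs (conj oV Vx)).
have [yx|yx] := eqVneq y x.
  have [z [zy Az Vz]] := ly V (open_nbhs_nbhs (conj oV Vy)).
  by exists z; split; [rewrite -yx | | exact: VU].
by exists y; split => //; exact: VU.
Qed.

Lemma CBderiv_closed a : closed (CBderiv S a).
Proof.
elim: a => [|a IH|I f IH] /=; [exact: closedT | exact: derived_set_closed |].
by move=> x clx i; apply: IH => U /clx[y [fy Uy]]; exists y; split => //; apply: fy.
Qed.

Lemma CBderiv_chain a b :
  CBderiv S a `<=` CBderiv S b \/ CBderiv S b `<=` CBderiv S a.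
Proof.
have [ab|ba] := ole_total a b; first by right; exact: CBderiv_anti.
by left=> x /(CBderiv_anti ba)[].
Qed.

(** By [CBderiv_chain] the traces on [A] form a chain of nonempty closed sets. They generate a
    proper filter, and a cluster point of it lies in all of them. *)
Lemma compact_CBderiv_sup A I (f : I -> ord) (i0 : I) : compact A -> closed A ->
  (forall i, A `&` CBderiv S (f i) !=set0) -> A `&` CBderiv S (osup f) !=set0.
Proof.
move=> cA clA fA.
pose F := [set B | exists i, A `&` CBderiv S (f i) `<=` B].
have FF : ProperFilter F.
  split.
    by move=> [i Hi]; have [x Hx] := fA i; exact: (Hi x).
  split.
  - by exists i0.
  - move=> B C [i iB] [j jC].
    have [ij|ji] := CBderiv_chain (f i) (f j).
      by exists i => x [Ax fx]; split; [exact: iB | apply: jC; split=> //; exact: ij].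
    by exists j => x [Ax fx]; split; [apply: iB; split=> //; exact: ji | exact: jC].
  - by move=> B C BC [i iB]; exists i; exact: subset_trans iB BC.
have FA : F A by exists i0 => x [].
have [x [Ax clx]] := cA F FF FA.
exists x; split=> // i; apply: CBderiv_closed => U xU.
have FAi : F (A `&` CBderiv S (f i)) by exists i.
have [y [[_ fy] Uy]] := clx _ U FAi xU.
by exists y.
Qed.

(** Each point of the compact trace is isolated in the derivative, hence has a neighbourhood
    containing no other point of the trace; [compact_ind] adds up these finite pieces. *)
Lemma finite_CBderiv A a : compact A -> closed A ->
  A `&` CBderiv S (osucc a) = set0 -> finite_set (A `&` CBderiv S a).
Proof.
move=> cA clA A0.
have cAa : compact (A `&` CBderiv S a).
  by apply: compact_closedI => //; exact: CBderiv_closed.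
apply: (compact_ind cAa) => [|X Y fX fY|x [Ax ax]]; first exact: finite_set0.
  by rewrite finite_setU.
have : ~ limit_point (CBderiv S a) x.
  by move=> lx; have : set0 x by rewrite -A0.
rewrite not_limit_pointE => -[X xX aX]; exists X => //.
apply: (sub_finite_set _ (finite_set1 x)) => z [[_ az] Xz]; exact: aX.
Qed.

End compactness.

Lemma scatteredP (S : topologicalType) :
  scattered S <-> exists a, CBderiv S a = set0.
Proof.
split=> [[a Ha]|[a Ha]]; first by exists a; exact/Ha/ole_refl.
by exists a => b ab; apply/seteqP; split=> // x /(CBderiv_anti ab); rewrite Ha.
Qed.

(** A supremum is never the first stage at which the derivative vanishes: by compactness the
    intersection of nonempty derivatives is nonempty, and over an empty index it is the whole
    space. *)
Lemma height_succ (S : topologicalType) c : compact [set: S] ->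
  [set: S] !=set0 -> CBderiv S c = set0 ->
  exists2 a, is_height S (osucc a) & CBderiv S a !=set0.
Proof.
move=> cS [s _]; elim: c => [/seteqP[/(_ s)/(_ Logic.I)]//|c IH c0|I f IH f0].
  have [/eqP/IH//|/set0P cn0] := boolP (CBderiv S c == set0).
  exists c => //; split=> // b b0; have [//|bc] := ole_total (osucc c) b.
  by case: cn0 => x /(@CBderiv_anti _ b c bc); rewrite b0.
have [[i /IH//]|/forallNP nf] := pselect (exists i, CBderiv S (f i) = set0).
exfalso; have [[i0]|nI] := pselect (exists i : I, True).
  have clT : closed [set: S] by exact: closedT.
  have [|x [_]] := compact_CBderiv_sup (f := f) i0 cS clT; last by rewrite f0.
  by move=> i; rewrite setTI; apply/set0P/eqP; exact: nf.
by move/seteqP: f0 => [/(_ s) f0 _]; apply: f0 => i; case: nI; exists i.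
Qed.

(** * Closed relations and continuous images *)

(** [G] is a partial function from [Y] to [X]; extended by the value [x0], it maps [B] onto a set
    that covers [A]. *)
Lemma card_le_rel (X Y : Type) (A : set X) (B : set Y) (G : Y -> X -> Prop) :
  (forall y x x', G y x -> G y x' -> x = x') ->
  (forall x, A x -> exists2 y, G y x & B y) -> A #<= B.
Proof.
move=> Guniq GA.
have [->|/set0P[x0 _]] := eqVneq A set0; first exact: card_ge0.
have /choice[g gP] (y : Y) : exists x, (exists2 x', A x' & G y x') -> A x /\ G y x.
  have [[x' Ax' yx']|H] := pselect (exists2 x', A x' & G y x').
    by exists x'.
  by exists x0.
apply: card_le_trans (card_image_le g B); apply: subset_card_le => x Ax.
have [y yx By] := GA x Ax; exists y => //.
have [_ ygy] := gP y (ex_intro2 _ _ x Ax yx); exact: Guniq ygy yx.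
Qed.

Lemma nbhs_setX (X Y : topologicalType) (x : X) (y : Y) V U :
  nbhs x V -> nbhs y U -> nbhs (x, y) (V `*` U).
Proof. by move=> xV yU; exists (V, U). Qed.

Section closed_relation.
Context {K L : topologicalType} (G : set (K * L)).
Hypothesis cK : compact [set: K].
Hypothesis clG : closed G.
Hypothesis Guniq : forall x y y', G (x, y) -> G (x, y') -> y = y'.
Hypothesis Gsurj : forall y, exists x, G (x, y).

(** At a successor, points y' of the derivative tend to [y] with y' different from [y], and each has
    a related point x' in the derivative of [K]. A cluster point [x] of these x' is related to [y]
    because [G] is closed, and x' differs from [x] by [Guniq], so [x] is an accumulation point. At a
    supremum, the fibre over [y] is compact. *)
Lemma CBderiv_rel a y : CBderiv L a y -> exists2 x, G (x, y) & CBderiv K a x.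
Proof.
elim: a y => [|a IH|I f IH] y.
- by move=> _; have [x] := Gsurj y; exists x.
- move=> [ay ly].
  pose F := [set B : set K | exists2 U, nbhs y U & forall x y', U y' -> y' != y ->
     G (x, y') -> CBderiv K a x -> B x].
  have FF : ProperFilter F.
    split.
      move=> [U yU UF]; have [y' [y'y ay' Uy']] := ly U yU.
      by have [x xy' ax] := IH _ ay'; exact: UF xy' ax.
    split.
    + by exists setT => //; exact: filterT.
    + move=> B C [U yU UB] [V yV VC]; exists (U `&` V); first exact: filterI.
      move=> x y' [Uy' Vy'] y'y xy' ax.
      by split; [exact: UB xy' ax | exact: VC xy' ax].
    + move=> B C BC [U yU UB]; exists U => // x y' Uy' y'y xy' ax.
      by apply: BC; exact: UB xy' ax.
  have [x [_ clx]] := cK FF (@filterT _ F _).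
  have xV U V : nbhs y U -> nbhs x V -> exists x' y',
      [/\ V x', U y', y' != y, G (x', y') & CBderiv K a x'].
    move=> yU xV; have [|x' [[y' [Uy' y'y x'y' ax']] Vx']] :=
      clx [set x' | exists y', [/\ U y', y' != y, G (x', y') & CBderiv K a x']] V _ xV.
      by exists U => // x' y' *; exists y'.
    by exists x', y'.
  have Gxy : G (x, y).
    apply: clG => W [[V U]/= [xV' yU] VUW].
    have [x' [y' [Vx' Uy' _ x'y' _]]] := xV _ _ yU xV'.
    by exists (x', y'); split => //; exact: VUW.
  exists x => //; split.
    apply: CBderiv_closed => V xV'.
    have [x' [y' [Vx' _ _ _ ax']]] := xV _ _ filterT xV'.
    by exists x'.
  move=> V xV'.
  have [x' [y' [Vx' _ y'y x'y' ax']]] := xV _ _ filterT xV'.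
  exists x'; split=> //; apply: contra_neq y'y => x'x.
  by apply: Guniq Gxy; rewrite -x'x.
- move=> fy; have [[i0]|nI] := pselect (exists i : I, True); last first.
    by have [x xy] := Gsurj y; exists x => // i; case: nI; exists i.
  have clA : closed [set x | G (x, y)].
    move=> x clx; apply: clG => W [[V U]/= [xV yU] VUW].
    have [x' [x'y Vx']] := clx _ xV.
    by exists (x', y); split=> //; apply: VUW; split=> //; exact: nbhs_singleton.
  have cA : compact [set x | G (x, y)] by exact: subclosed_compact clA cK _.
  have [|x [xy fx]] := compact_CBderiv_sup (f := f) i0 cA clA; last by exists x.
  by move=> i; have [x xy ix] := IH i y (fy i); exists x.
Qed.

Lemma card_CBderiv_rel a : CBderiv L a #<= CBderiv K a.
Proof.
apply: (@card_le_rel _ _ _ _ (fun x y => G (x, y))) => [x y y'|y].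
  exact: Guniq.
exact: CBderiv_rel.
Qed.

End closed_relation.

Lemma nonscattered_CBderiv (S : topologicalType) :
  ~ scattered S <-> forall a, CBderiv S a !=set0.
Proof.
rewrite scatteredP -forallNP; split=> H a; first exact/set0P/eqP/H.
by have /set0P/eqP := H a.
Qed.

Lemma card_CBderiv_scattered (K L : topologicalType) :
  (forall a, CBderiv L a #<= CBderiv K a) ->
  (~ scattered L -> ~ scattered K) /\
  (scattered L ->
     forall a : ord, is_height L (osucc a) -> CBderiv L a #<= CBderiv K a).
Proof.
move=> LK; split=> [|_ a _]; last exact: LK.
rewrite !nonscattered_CBderiv => Ln a; apply/set0P; apply: contraPneq (LK a) => ->.
by move/card_le0P; apply/eqP/set0P.
Qed.

(** The graph of [g] over [F] is a closed relation since [F] is closed and [L] is Hausdorff. *)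
Lemma closed_image_card_CBderiv (K L : topologicalType) (F : set K) (g : K -> L) :
  compact [set: K] -> hausdorff_space L -> closed F ->
  {within F, continuous g} -> g @` F = [set: L] ->
  forall a, CBderiv L a #<= CBderiv K a.
Proof.
move=> cK L2 clF cg gF a.
apply: (@card_CBderiv_rel _ _ [set p | F p.1 /\ g p.1 = p.2]) => //.
- move=> [x y] clxy.
  have Fx : F x.
    apply: clF => V xV; have [[x' y'] [[/= Fx' _] [Vx' _]]] :=
      clxy (V `*` setT) (nbhs_setX xV (@filterT _ (nbhs y) _)).
    by exists x'.
  split=> //=; apply: L2 => U V gxU yV.
  have /(_ U gxU) : g @ (within F (nbhs x)) --> g x.
    by have := cg x; rewrite /continuous_at nbhs_subspace_in.
  rewrite /= => xU.
  have [[x' y'] [[/= Fx' gx'] [Hx' Vy']]] := clxy (_ `*` V) (nbhs_setX xU yV).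
  by exists y'; split=> //; rewrite -gx'; exact: Hx'.
- by move=> x y y' [_ /= <-] [_ /= <-].
- move=> y; have [x Fx gx] : (g @` F) y by rewrite gF.
  by exists x.
Qed.

(** * Separation by continuous functions *)

Lemma bump (R : realType) (L : topologicalType) (y : L) (U : set L) :
  hausdorff_space L -> compact [set: L] -> nbhs y U ->
  exists e : L -> R, [/\ continuous e, forall z, 0 <= e z <= 1,
    forall z, ~ U z -> e z = 0 & \forall z \near y, e z = 1].
Proof.
move=> L2 cL; rewrite nbhsE => -[V [oV Vy] VU].
have nL : normal_space L by exact: compact_normal.
have clV : closed (~` V) by exact: open_closedC.
have cly : closed [set y].
  exact/accessible_closed_set1/hausdorff_accessible.
have /(@uniform_separatorP _ R)[u [cu u01 u0 u1]] : uniform_separator (~` V) [set y].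
  apply: (normal_uniform_separator nL) => //.
  by apply/seteqP; split=> // z [nVz zy]; case: nVz; rewrite zy.
have uy : u y = 1 by apply: u1; exists y.
have ubnd z : 0 <= u z <= 1.
  by have /u01 : range u (u z) by []; rewrite /= in_itv.
(* Doubling and truncating the Urysohn function makes it 1 wherever [u] exceeds 1/2, thus near [y]
   and not only at [y]. *)
exists ((fun=> 1 : R^o) \min (fun z => 2 * u z : R^o)); split.
- move=> z; apply: continuous_min; first exact: cvg_cst.
  by apply: cvgM; [exact: cvg_cst | exact: cu].
- move=> z; have /andP[u0z _] := ubnd z.
  by rewrite /= ge_min lexx le_min ler01 mulr_ge0.
- move=> z nUz /=; have -> : u z = 0 by apply: u0; exists z => // /VU.
  by rewrite mulr0 min_r.
- have : \forall z \near y, 2^-1 < u z.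
    apply: (cu y [set t | 2^-1 < t]); rewrite uy; apply: lt_nbhsr.
    by rewrite invf_lt1 ?ltr1n.
  by apply: filterS => z uz; rewrite /= min_l// mulrC -ler_pdivrMr// mul1r ltW.
Qed.

Lemma nbhs_disjoint (S : topologicalType) (x y : S) : hausdorff_space S ->
  x != y -> exists U V, [/\ nbhs x U, nbhs y V & U `&` V = set0].
Proof.
rewrite open_hausdorff => S2 /S2[[U V]/= [+ +] [oU oV /eqP UV]].
rewrite !inE => Ux Vy; exists U, V.
by split=> //; apply: open_nbhs_nbhs.
Qed.

Lemma Cont_max_norm (R : realType) (K : topologicalType)
    (hK : compact [set: K]) (E : normedModType R) (f : Cont hK E) :
  [set: K] !=set0 -> exists x, `|f x| = `|f|.
Proof.
move=> K0; have cf : {within [set: K], continuous (fun x => `|f x|)}.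
  apply: continuous_subspaceT => x.
  apply: (@continuous_comp K E R f Num.norm); first exact: Cont_continuous.
  exact: norm_continuous.
have [x _ Hx] := compact_EVT_max K0 hK cf; exists x; apply/eqP.
rewrite eq_le ler_supnorm/=; apply: supnorm_le => // z; exact/Hx/mem_set.
Qed.

(** * Embeddings of small distortion *)

Lemma Cont_sumE (R : realType) (L : topologicalType) (hL : compact [set: L])
    (E : normedModType R) (I : Type) (r : seq I) (f : I -> Cont hL E) z :
  (\sum_(i <- r) f i) z = \sum_(i <- r) f i z.
Proof. exact: (big_morph (fun f : Cont hL E => f z)). Qed.

(** The sum on the left is the value at [x] of [S h], where [h] adds up the functions of [l] with
    the signs of their images at [x]; the hypothesis on [l] gives [h] norm at most 1. *)
Lemma sum_norm_le_signs (R : realType) (L K : topologicalType)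
    (hL : compact [set: L]) (hK : compact [set: K])
    (S : {linear Cont hL R -> Cont hK R}) (M : R) (l : seq (Cont hL R)) x :
  0 <= M -> (forall f : Cont hL R, `|S f| <= M * `|f|) ->
  (forall z, \sum_(e <- l) `|e z| <= 1) -> \sum_(e <- l) `|S e x| <= M.
Proof.
move=> M0 SM l1.
pose h : Cont hL R := \sum_(e <- l) Num.sg (S e x : R) *: e.
have Sh : \sum_(e <- l) `|S e x| = S h x.
  rewrite linear_sum Cont_sumE; apply: eq_bigr => e _.
  by rewrite linearZ/= normrEsg.
have h1 : `|h| <= 1.
  apply: supnorm_le => // z; rewrite Cont_sumE (le_trans (ler_norm_sum _ _ _))//.
  apply: le_trans (l1 z); apply: ler_sum => e _.
  have key (b c : R) : `|Num.sg b * c| <= `|c|.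
    by rewrite normrM ler_piMl// normr_sg lern1 leq_b1.
  exact: key.
rewrite Sh (le_trans (ler_norm _))// (le_trans (ler_supnorm _ _))//.
by rewrite (le_trans (SM _))// ler_piMr.
Qed.

(* Arithmetic on values of [Cont] elements is done in such lemmas over a plain
   [R] and transported by conversion: [lra] does not recognise the operations
   that come from viewing [R] as a normed module. *)
Lemma norm_1B2D2_le (R : realFieldType) (a : R) :
  0 <= a <= 1 -> `|1 - 2 * 1 + 2 * a| <= 1.
Proof. by move=> /andP[a0 a1]; rewrite ler_norml; apply/andP; split; lra. Qed.

Lemma norm_1B2_le (R : realFieldType) (a : R) : 0 <= a <= 1 -> `|1 - 2 * a| <= 1.
Proof. by move=> /andP[a0 a1]; rewrite ler_norml; apply/andP; split; lra. Qed.

Section small_distortion.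
Context {R : realType} {L K : topologicalType}.
Context {hL : compact [set: L]} {hK : compact [set: K]}.
Hypothesis L2 : hausdorff_space L.
Hypothesis K0 : [set: K] !=set0.
Variables (S : {linear Cont hL R -> Cont hK R}) (M : R).
Hypothesis S_le : forall f, `|S f| <= M * `|f|.
Hypothesis S_ge : forall f : Cont hL R, `|f| <= `|S f|.
Hypothesis M0 : 0 <= M.
Hypothesis M3 : M < 3.
Local Notation C := (Cont hL R).
Implicit Types (f e : C) (U V : set L) (a : ord).

Let eta := (3 - M) / 2.

Let eta_gt0 : 0 < eta.
Proof. by rewrite divr_gt0// subr_gt0. Qed.

Let Sx_le f x : `|f| <= 1 -> `|S f x| <= M.
Proof.
move=> f1; rewrite (le_trans (ler_supnorm _ _))// (le_trans (S_le f))//.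
by rewrite ler_piMr.
Qed.

Definition bumps U : set C :=
  [set e | (forall z, 0 <= e z <= 1) /\ forall z, ~ U z -> e z = 0].

(* The factor 2 makes |f + 2 e| reach 3 > M while |f - 2 e| stays at most 1
   when f = 1 on U. *)
Definition peaks f U : set K :=
  [set x | exists2 e, bumps U e & 3 <= `|S (f + 2 *: e) x|].

Lemma peaksS f U V : U `<=` V -> peaks f U `<=` peaks f V.
Proof.
move=> UV x [e [e01 eU] ex]; exists e => //; split=> // z nVz.
by apply: eU => /UV.
Qed.

(** Write f + 2 e = h + 2 g with h = f - 2 g + 2 e. On [U] this [h] is 2 e - 1, and off [U] it is f
    - 2 g, so it has norm at most 1. Hence 3 <= M + 2 |S g x| at a peak, and the bound passes to the
    closure. *)
Lemma peaks_ge (f g : C) U x :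
  (forall z, `|f z - 2 * g z| <= 1) -> (forall z, U z -> f z = 1 /\ g z = 1) ->
  closure (peaks f U) x -> eta <= `|S g x|.
Proof.
move=> fg U1 clx.
have cl : closed [set x : K | eta <= `|S g x|].
  have cS : continuous (fun x : K => `|S g x|).
    move=> t; apply: (@continuous_comp K R^o R (S g) Num.norm).
      exact: Cont_continuous.
    exact: norm_continuous.
  by move/continuous_closedP : cS => /(_ _ (@closed_ge _ eta)).
apply: cl; apply: closureS clx => z [e [e01 eU]] /=.
set h := f - 2 *: g + 2 *: e => ez.
have h1 : `|h| <= 1.
  apply: supnorm_le => // t; rewrite [X in `|X|]/(f t - 2 * g t + 2 * e t).
  have [Ut|nUt] := pselect (U t).
    have [-> ->] := U1 t Ut; exact/norm_1B2D2_le/e01.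
  have key (b c d : R) : d = 0 -> `|b - 2 * c| <= 1 -> `|b - 2 * c + 2 * d| <= 1.
    by move=> ->; rewrite mulr0 addr0.
  exact: key (eU _ nUt) (fg t).
have hg : f + 2 *: e = h + 2 *: g.
  have key (X : zmodType) (u v w : X) : u + w = u - v + w + v.
    by rewrite addrAC subrK.
  exact: key.
have key (b c d : R) : 3 <= `|d| -> d = b + 2 * c -> `|b| <= M -> eta <= `|c|.
  move=> d3 dE bM; have : `|d| <= `|b| + 2 * `|c|.
    by rewrite dE (le_trans (ler_normD _ _))// normrM ger0_norm.
  by rewrite /eta; lra.
apply: key ez _ (Sx_le z h1).
by rewrite hg linearD linearZ.
Qed.

(** For a bump [e] at [y] the function f + 2 e takes the value 3 at [y]. Its image under [S] has
    norm at least 3, and this norm is attained. *)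
Lemma peaks_nonempty f U (y : L) : nbhs y U -> (forall z, U z -> f z = 1) ->
  peaks f U !=set0.
Proof.
move=> yU f1; have [e [ce e01 eU /nbhs_singleton ey]] := bump R L2 hL yU.
pose e' : C := mkCont ce.
have [x Sx] := Cont_max_norm (S (f + 2 *: e')) K0.
exists x, e'; first by [].
rewrite Sx (le_trans _ (S_ge _))// (le_trans _ (ler_supnorm _ y))//.
have key (b c : R) : b = 1 -> c = 1 -> 3 <= `|b + 2 * c|.
  by move=> -> ->; rewrite ger0_norm; lra.
exact: key (f1 y (nbhs_singleton yU)) ey.
Qed.

(** A gliding hump: pick another point y' of the derivative near [y], separate the two, place one
    bump at y' and the remaining ones in the part of [V] on the side of [y]. The supports are
    disjoint, which keeps the sum of the absolute values at most 1. *)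
Lemma peaks_gliding f U a y (s : seq K) : (forall z, `|f z| <= 1) ->
  (forall z, U z -> f z = 1) ->
  (forall V z, V `<=` U -> nbhs z V -> CBderiv L a z ->
     exists2 x, closure (peaks f V) x & x \in s) ->
  CBderiv L (osucc a) y -> forall N V, V `<=` U -> nbhs y V ->
  exists l : seq C, [/\ size l = N, forall z, \sum_(e <- l) `|e z| <= 1,
    forall z, ~ V z -> \sum_(e <- l) `|e z| = 0 &
    forall e, e \in l -> exists2 x, x \in s & eta <= `|S e x|].
Proof.
move=> f1 fU IH [ay ly]; elim=> [|N IHN] V VU yV.
  by exists [::]; split=> // z; rewrite big_nil.
have [y' [y'y ay' Vy']] := ly V^° (nbhs_interior yV).
have [W [X [y'W yX WX]]] := nbhs_disjoint L2 y'y.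
have yVX : nbhs y (V `&` X) by exact: filterI.
have VXU : V `&` X `<=` U by move=> z [/VU].
have [l [lN l1 l0 leta]] := IHN _ VXU yVX.
have y'VW : nbhs y' (V `&` W) by exact: filterI.
have [e [ce e01 e0 e1]] := bump R L2 hL y'VW.
pose e' : C := mkCont ce.
have e'0 z : ~ (V `&` W) z -> e' z = 0 by exact: e0.
have e'01 z : `|e' z| <= 1.
  have key (b : R) : 0 <= b <= 1 -> `|b| <= 1.
    by move=> /andP[b0 b1]; rewrite ger0_norm.
  exact/key/e01.
exists (e' :: l); split=> [|z|z nVz|g].
- by rewrite /= lN.
- rewrite big_cons.
  have [[Vz Wz]|nVWz] := pselect ((V `&` W) z).
    rewrite l0 ?addr0// => -[_ Xz].
    by have : set0 z by rewrite -WX.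
  by rewrite e'0// normr0 add0r.
- by rewrite big_cons e'0 ?l0 ?normr0 ?addr0// => -[].
- rewrite inE => /predU1P[->|]; last exact: leta.
  (* [peaks_ge] requires both [f] and the new bump to be 1 on the set where peaks are taken. *)
  set V' := V `&` W `&` [set z | e z = 1].
  have V'U : V' `<=` U by move=> z [[/VU]].
  have [x clx xs] : exists2 x, closure (peaks f V') x & x \in s.
    by apply: IH ay' => //; exact: filterI.
  exists x => //; apply: peaks_ge clx => z; last first.
    by move=> V'z; split; [exact/fU/V'U | case: V'z].
  have [Uz|nUz] := pselect (U z).
    rewrite fU//=; exact/norm_1B2_le/e01.
  by rewrite /= e'0 ?mulr0 ?subr0// => -[/VU].
Qed.

Lemma peaks_CBderiv f U a y : (forall z, `|f z| <= 1) ->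
  (forall z, U z -> f z = 1) -> nbhs y U -> CBderiv L a y ->
  closure (peaks f U) `&` CBderiv K a !=set0.
Proof.
move=> f1; elim: a U y => [|a IH|I g IH] U y fU yU ay.
- have [x px] := peaks_nonempty yU fU.
  by exists x; split=> //; exact: subset_closure.
- apply/set0P/eqP => cl0.
  have clcl : closed (closure (peaks f U)) by exact: closed_closure.
  have ccl : compact (closure (peaks f U)) by exact: subclosed_compact clcl hK _.
  have /finite_seqP[s sE] := finite_CBderiv ccl clcl cl0.
  (* With [N] bumps the double sum of the |S e x| is at least N eta, each bump contributing [eta] at
     some point of [s]. By [sum_norm_le_signs] each point of [s] accounts for at most [M], so N eta
     <= |s| M. *)
  have [N /= NM] : exists N : nat, (size s)%:R * M / eta < N%:R.
    by exists (Num.truncn ((size s)%:R * M / eta)).+1; exact: truncnS_gt.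
  have [V z VU zV az|l [lN l1 _ leta]] :=
    peaks_gliding (s := s) f1 fU _ ay N (@subset_refl _ U) yU.
    have [x [clx ax]] := IH V z (fun t Vt => fU t (VU t Vt)) zV az.
    exists x => //; have : [set` s] x; last by [].
    by rewrite -sE; split=> //; apply: closureS clx; exact: peaksS.
  have : \sum_(e <- l) eta <= \sum_(e <- l) \sum_(x <- s) `|S e x|.
    rewrite big_seq [leRHS]big_seq; apply: ler_sum => e /leta[x xs ex].
    by rewrite (le_trans ex)// (big_rem x)//= lerDl sumr_ge0.
  have sumc (T : Type) (r : seq T) (c : R) : \sum_(x <- r) c = (size r)%:R * c.
    by rewrite big_const_seq count_predT iter_addr_0 mulr_natl.
  rewrite sumc lN; apply/negP; rewrite -ltNge exchange_big/=.
  move: NM; rewrite ltr_pdivrMr//; apply: le_lt_trans.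
  rewrite -sumc; apply: ler_sum => x _; exact: sum_norm_le_signs.
- have [[i0 _]|nI] := pselect (exists i : I, True); last first.
    have [x px] := peaks_nonempty yU fU.
    exists x; split; first exact: subset_closure.
    by move=> i; case: nI; exists i.
  have clcl : closed (closure (peaks f U)) by exact: closed_closure.
  have ccl : compact (closure (peaks f U)) by exact: subclosed_compact clcl hK _.
  have H i : closure (peaks f U) `&` CBderiv K (g i) !=set0.
    exact: IH fU yU (ay i).
  exact: compact_CBderiv_sup i0 ccl clcl H.
Qed.


Lemma nbhs_seq_disjoint (s : seq L) : exists V : L -> set L,
  (forall x, nbhs x (V x)) /\
  forall x y, x \in s -> y \in s -> x != y -> V x `&` V y = set0.
Proof.
have /choice[W HW] (p : L * L) : exists AB : set L * set L, p.1 != p.2 ->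
    [/\ nbhs p.1 AB.1, nbhs p.2 AB.2 & AB.1 `&` AB.2 = set0].
  have [|ne] := eqVneq p.1 p.2; first by exists (set0, set0).
  by have [A [B HAB]] := nbhs_disjoint L2 ne; exists (A, B).
(* The neighbourhoods chosen for (x, y) and for (y, x) may differ; intersecting them makes [U x y]
   and [U y x] disjoint. *)
pose U x y := (W (x, y)).1 `&` (W (y, x)).2.
have nU x y : x != y -> nbhs x (U x y).
  move=> xy; have [xA _ _] := HW (x, y) xy.
  by rewrite eq_sym in xy; have [_ xB _] := HW (y, x) xy; exact: filterI.
exists (fun x => [set z | forall y, y \in s -> x != y -> U x y z]).
split=> [x|x y xs ys xy].
  elim: s => [|y s IH]; first by apply: filterS filterT => z.
  have : nbhs x [set z | x != y -> U x y z].
    have [->|xy] := eqVneq x y; first exact: filterE.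
    by apply: filterS (nU _ _ xy) => z ?.
  move=> xy; apply: filterS (filterI xy IH) => z [zy zs] y'.
  by rewrite inE => /predU1P[-> //|]; exact: zs.
apply/seteqP; split=> // z [/(_ y ys xy)[zA _] /(_ x xs)].
rewrite eq_sym => /(_ xy)[_ zB].
by have [_ _ <-] := HW (x, y) xy.
Qed.

(** With more points in [s] than in [t], the matrix of values at [t] of the images of bumps at [s]
    has a nonzero left kernel. This gives a combination [f] of bumps whose image vanishes on
    [CBderiv K a], whereas [peaks_CBderiv] and [peaks_ge] with [g] equal to [f] provide a point
    there with |S f x| >= eta. *)
Lemma CBderiv_count a (s : seq L) (t : seq K) : uniq s ->
  (forall y, y \in s -> CBderiv L a y) ->
  (forall x, CBderiv K a x -> x \in t) -> (size s <= size t)%N.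
Proof.
move=> us sa ta; rewrite leqNgt; apply/negP => ts.
have [V [nV dV]] := nbhs_seq_disjoint s.
have /choice[b Hb] (y : L) : exists e : C, [/\ forall z, 0 <= e z <= 1,
    forall z, ~ V y z -> e z = 0 & \forall z \near y, e z = 1].
  by have [e [ce e01 e0 e1]] := bump R L2 hL (nV y); exists (mkCont ce).
have b01 y z : 0 <= (b y z : R) <= 1 by have [H _ _] := Hb y; exact: H.
have b0 y z : ~ V y z -> b y z = 0 by have [_ H _] := Hb y; exact: H.
have b_one y : \forall z \near y, b y z = 1 by have [] := Hb y.
pose n := size s; pose m := size t.
pose p (i : 'I_n) := tnth (in_tuple s) i; pose q (j : 'I_m) := tnth (in_tuple t) j.
have ps i : p i \in s by exact: mem_tnth.
have p_inj i k : i != k -> p i != p k.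
  by apply: contra_neq => /(tuple_uniqP (in_tuple s) us).
pose A : 'M[R]_(n, m) := \matrix_(i, j) S (b (p i)) (q j).
have kerA : kermx A != 0.
  rewrite -mxrank_eq0 mxrank_ker -lt0n subn_gt0.
  exact: leq_ltn_trans (rank_leq_col A) ts.
have /rowV0Pn[u /sub_kermxP uA u0] := kerA.
(* Normalising at the largest entry makes the combination of bumps equal to 1
   near [p i1] while keeping its norm at most 1. *)
have [i0 ui0] : exists i, u 0 i != 0.
  apply/existsP; move: u0; apply: contraNT => /existsPn u0.
  by apply/eqP/rowP => i; rewrite mxE; exact/eqP/negPn/u0.
pose i1 := [arg max_(i > i0) `|u 0 i|]%O.
have ui1 k : `|u 0 k| <= `|u 0 i1|.
  by rewrite /i1; case: arg_maxP => // i _; exact.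
have ui1_gt0 : 0 < `|u 0 i1| by rewrite (lt_le_trans _ (ui1 i0))// normr_gt0.
pose c k := u 0 k / u 0 i1.
have c1 k : `|c k| <= 1 by rewrite normrM normfV ler_pdivrMr// mul1r.
pose f : C := \sum_k c k *: b (p k).
have fE z : f z = \sum_k c k * (b (p k) z : R) by rewrite Cont_sumE.
have fV i z : V (p i) z -> f z = c i * (b (p i) z : R).
  move=> Vz; rewrite fE (bigD1 i)//= big1 ?addr0// => k ki.
  rewrite b0 ?mulr0// => Vkz; have : (V (p k) `&` V (p i)) z by [].
  by rewrite dV// p_inj.
have f1 z : `|f z| <= 1.
  have [[i Vz]|nV0] := pselect (exists i, V (p i) z).
    rewrite (fV i)// normrM; apply: mulr_ile1 => //.
    by have /andP[b0z b1z] := b01 (p i) z; rewrite ger0_norm.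
  rewrite fE big1 ?normr0// => k _; rewrite b0 ?mulr0// => Vz.
  by apply: nV0; exists k.
pose U := V (p i1) `&` [set z | b (p i1) z = 1].
have fU z : U z -> f z = 1.
  by move=> [Vz bz]; rewrite (fV i1)// bz mulr1 /c divff// -normr_gt0.
have yU : nbhs (p i1) U by apply: filterI; [exact: nV | exact: b_one].
have [x [clx /ta xt]] := peaks_CBderiv f1 fU yU (sa _ (ps i1)).
have [j xj] : exists j, x = q j by exact/tnthP.
have : eta <= `|S f x|.
  apply: peaks_ge clx => z; last by move=> Uz; rewrite !fU.
  have key (d : R) : `|d| <= 1 -> `|d - 2 * d| <= 1.
    by rewrite mulr_natl mulr2n opprD addNKr normrN.
  exact: key.
have -> : S f x = (u *m A) 0 j / u 0 i1 :> R.
  rewrite linear_sum Cont_sumE mxE mulr_suml; apply: eq_bigr => k _.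
  by rewrite linearZ mxE -xj /c mulrAC.
by rewrite uA mxE mul0r normr0 leNgt eta_gt0.
Qed.

End small_distortion.

Lemma small_distortion_CBderiv (R : realType) (L K : topologicalType)
    (hL : compact [set: L]) (hK : compact [set: K])
    (S : {linear Cont hL R -> Cont hK R}) (M : R) :
  hausdorff_space L -> [set: K] !=set0 -> 0 <= M -> M < 3 ->
  (forall f : Cont hL R, `|S f| <= M * `|f|) ->
  (forall f : Cont hL R, `|f| <= `|S f|) ->
  (~ scattered L -> ~ scattered K) /\
  (scattered L ->
     forall a : ord, is_height L (osucc a) -> CBderiv L a #<= CBderiv K a).
Proof.
move=> L2 K0 M0 M3 SM Sge; split=> [|_ a [La _]].
  rewrite !nonscattered_CBderiv => Ln a; have [y ay] := Ln a.
  have c1 : continuous ((fun=> 1) : L -> R) by move=> x; exact: cvg_cst.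
  pose f : Cont hL R := mkCont c1.
  have f1 z : `|f z| <= 1 by rewrite [leLHS]normr1.
  have fT z : setT z -> f z = 1 by [].
  have [x [_ ax]] := peaks_CBderiv L2 K0 SM Sge M0 M3 f1 fT (@filterT _ (nbhs y) _) ay.
  by exists x.
have fLa : finite_set (CBderiv L a).
  rewrite -[CBderiv L a]setTI.
  by apply: finite_CBderiv; rewrite ?setTI//; exact: closedT.
(* An infinite derivative of [K] dominates the finite one of [L] through the natural numbers; two
   finite sets remain to be counted. *)
have [fKa|/infiniteP nK] := pselect (finite_set (CBderiv K a)); last first.
  have [n /card_eqPle[Ln _]] := fLa.
  by apply: card_le_trans nK; apply: card_le_trans (card_leT `I_n).
have [n /card_eqPle[Ln nL]] := fLa; have [m /card_eqPle[Km mK]] := fKa.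
apply: card_le_trans (card_le_trans _ mK); first exact: Ln.
rewrite card_le_II (leq_trans (leq_card_fset_set fLa nL))//.
apply: leq_trans (geq_card_fset_set Km).
apply: (CBderiv_count L2 K0 SM Sge M0 M3 (a := a)) => [|y|x ax].
- exact: finmap.fset_uniq.
- by rewrite in_fset_set// inE.
- by rewrite in_fset_set// inE.
Qed.

(** * Operator norms and the normalisation of embeddings *)

Lemma opnorm_ge0 (R : realType) (X Y : normedModType R) (V : set X) (T : X -> Y) :
  bounded_on V T -> V 0 -> 0 <= opnorm V T.
Proof.
move=> [M TM] V0; apply: le_trans (normr_ge0 (T 0)) _; apply: ub_le_sup.
  (* The constant [M] may be negative, so its absolute value is the upper bound. *)
  exists `|M| => _ [v [Vv /= v1] <-]; rewrite (le_trans (TM v Vv))//.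
  by rewrite (le_trans (ler_wpM2r _ (ler_norm M)))// ler_piMr.
by exists 0 => //; split=> //=; rewrite normr0.
Qed.

Lemma ler_opnorm (R : realType) (X Y : normedModType R) (V : set X) (T : X -> Y) v :
  bounded_on V T -> (forall k u, V u -> V (k *: u)) ->
  (forall k u, V u -> T (k *: u) = k *: T u) -> V v ->
  `|T v| <= opnorm V T * `|v|.
Proof.
move=> [M TM] VZ TZ Vv; have [->|v0] := eqVneq v 0.
  by rewrite -(scale0r v) TZ// !scale0r !normr0 mulr0.
rewrite -ler_pdivrMr ?normr_gt0// mulrC.
have -> : `|v|^-1 * `|T v| = `|T (`|v|^-1 *: v)|.
  by rewrite TZ// normrZ normfV normr_id.
apply: ub_le_sup; last first.
  exists (`|v|^-1 *: v) => //; split; first exact: VZ.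
  by rewrite /= normrZ normfV normr_id mulVf// normr_eq0.
exists `|M| => _ [u [Vu /= u1] <-]; rewrite (le_trans (TM u Vu))//.
by rewrite (le_trans (ler_wpM2r _ (ler_norm M)))// ler_piMr.
Qed.

(** Multiplying [T] by the norm [B] of its inverse gives an operator that decreases no norm and is
    bounded by A B < 3. *)
Lemma embedding_CBderiv (R : realType) (L K : topologicalType)
    (hL : compact [set: L]) (hK : compact [set: K])
    (T : {linear Cont hL R -> Cont hK R}) (Tinv : Cont hK R -> Cont hL R) :
  hausdorff_space L -> [set: K] !=set0 ->
  bounded_on setT T -> cancel T Tinv -> bounded_on (range T) Tinv ->
  opnorm setT T * opnorm (range T) Tinv < 3 ->
  (~ scattered L -> ~ scattered K) /\
  (scattered L ->
     forall a : ord, is_height L (osucc a) -> CBderiv L a #<= CBderiv K a).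
Proof.
move=> L2 K0 bT TK bTinv T3.
set A := opnorm setT T in T3; set B := opnorm _ _ in T3.
have A0 : 0 <= A by exact: opnorm_ge0.
have B0 : 0 <= B by apply: opnorm_ge0 => //; exists 0 => //; exact: linear0.
have TA f : `|T f| <= A * `|f|.
  by apply: ler_opnorm => // k u _; rewrite linearZ.
have BT f : `|f| <= B * `|T f|.
  rewrite -{1}(TK f); apply: ler_opnorm => //.
  - by move=> k _ [u _ <-]; exists (k *: u); rewrite ?linearZ.
  - by move=> k _ [u _ <-]; rewrite -linearZ/= !TK.
pose S : {linear Cont hL R -> Cont hK R} := B \*: T.
have SE f : `|S f| = B * `|T f| by rewrite [LHS]normrZ ger0_norm.
apply: (small_distortion_CBderiv (S := S) L2 K0 (mulr_ge0 A0 B0) T3) => f.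
  by rewrite SE (mulrC A) -mulrA ler_wpM2l.
by rewrite SE.
Qed.

Lemma isometric_embedding (R : realType) (X Y : normedModType R)
    (T : {linear X -> Y}) : isometric T ->
  exists Tinv : Y -> X,
    [/\ bounded_on setT T, cancel T Tinv, bounded_on (range T) Tinv &
        opnorm setT T * opnorm (range T) Tinv <= 1].
Proof.
move=> iT; have Tinj : injective T.
  move=> u v uv; apply/eqP; rewrite -subr_eq0 -normr_eq0 -iT linearB/= uv.
  by rewrite subrr normr0.
have /choice[Tinv HT] (w : Y) : exists u, range T w -> T u = w.
  by have [[u _ uw]|] := pselect (range T w); [exists u | exists 0].
have TK : cancel T Tinv by move=> u; apply: Tinj; rewrite HT//; exists u.
have bT : bounded_on setT T by exists 1 => v _; rewrite mul1r iT.
have bTinv : bounded_on (range T) Tinv.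
  by exists 1 => _ [u _ <-]; rewrite mul1r TK iT.
have R0 : range T 0 by exists 0 => //; exact: linear0.
exists Tinv; split=> //; rewrite mulr_ile1 ?opnorm_ge0//.
- apply: ge_sup; first by exists `|T 0|, 0 => //; split=> //=; rewrite normr0.
  by move=> _ [v [_ /= v1] <-]; rewrite iT.
- apply: ge_sup; first by exists `|Tinv 0|, 0 => //; split=> //=; rewrite normr0.
  by move=> _ [_ [[u _ <-] /= u1] <-]; rewrite TK -iT.
Qed.

(** * Isometries into strictly convex spaces *)

Section strictly_convex_isometry.
Context {R : realType} {L K : topologicalType}.
Context {hL : compact [set: L]} {hK : compact [set: K]}.
Context {E : normedModType R}.
Hypothesis L2 : hausdorff_space L.
Hypothesis K0 : [set: K] !=set0.
Hypothesis Econv : strictly_convex E.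
Variable T : {linear Cont hL R -> Cont hK E}.
Hypothesis iT : isometric T.
Local Notation C := (Cont hL R).
Implicit Types (f g : C) (x : K) (y : L).

Definition peak_at y : set C := [set f | (forall z, `|f z| <= 1) /\ f y = 1].

(** As [T] is isometric, the inequality says that [T f] attains its norm 1 at the first
    coordinate. *)
Definition peak_rel : set (K * L) :=
  [set p | forall f, peak_at p.2 f -> 1 <= `|T f p.1|].

Let Tx_le f x : (forall z, `|f z| <= 1) -> `|T f x| <= 1.
Proof.
by move=> f1; rewrite (le_trans (ler_supnorm _ _))// [leLHS]iT; exact: supnorm_le.
Qed.

Let closed_norm_ge f (c : R) : closed [set x | c <= `|T f x|].
Proof.
have cT : continuous (fun x : K => `|T f x|).
  move=> t; apply: (@continuous_comp K E R (T f) Num.norm).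
    exact: Cont_continuous.
  exact: norm_continuous.
by move/continuous_closedP : cT => /(_ _ (@closed_ge _ c)).
Qed.

Let one : C := mkCont (fun x : L => cvg_cst (1 : R)).

Let half f g : C := 2^-1 *: (f + g).

Let peak_half y f g : peak_at y f -> peak_at y g -> peak_at y (half f g).
Proof.
move=> [f1 fy] [g1 gy]; split=> [z|].
  have key (a b : R) : `|a| <= 1 -> `|b| <= 1 -> `|2^-1 * (a + b)| <= 1.
    by rewrite !ler_norml => /andP[? ?] /andP[? ?]; apply/andP; split; lra.
  exact: key (f1 z) (g1 z).
have key (a b : R) : a = 1 -> b = 1 -> 2^-1 * (a + b) = 1.
  by move=> -> ->; lra.
exact: key fy gy.
Qed.

Let norm_half f g x : 1 <= `|T (half f g) x| -> 2 <= `|T f x + T g x|.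
Proof.
rewrite linearZ linearD [X in `|X|]/(2^-1 *: (T f x + T g x)) normrZ.
by rewrite ger0_norm ?invr_ge0//; lra.
Qed.

(** Where the image of the mean of two functions peaking at [y] has norm at least 1, so have both
    images. The closed sets [B f] therefore generate a filter, which is proper because each [T f]
    attains its norm; a cluster point lies in all of them. *)
Lemma peak_rel_surj y : exists x, peak_rel (x, y).
Proof.
pose B f : set K := [set x | 1 <= `|T f x|].
have Bhalf f g : peak_at y f -> peak_at y g -> B (half f g) `<=` B f `&` B g.
  move=> [f1 _] [g1 _] x /norm_half; have := ler_normD (T f x) (T g x).
  by have := Tx_le x f1; have := Tx_le x g1; rewrite /B /=; split; rewrite /=; lra.
have yone : peak_at y one by split=> // z; rewrite [leLHS]normr1.
pose F := [set A | exists2 f, peak_at y f & B f `<=` A].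
have FF : ProperFilter F.
  split.
    move=> [f [f1 fy] Bf]; have [x Tfx] := Cont_max_norm (T f) K0.
    apply: (Bf x); rewrite /B /= Tfx iT (le_trans _ (ler_supnorm _ y))//.
    by rewrite fy normr1.
  split; first by exists one.
  - move=> A A' [f yf fA] [g yg gA']; exists (half f g); first exact: peak_half.
    by move=> x /(Bhalf _ _ yf yg)[/fA ? /gA' ?].
  - by move=> A A' AA' [f yf fA]; exists f => //; exact: subset_trans fA AA'.
have [x [_ clx]] := hK FF (@filterT _ F _).
exists x => f yf; apply: closed_norm_ge => V xV.
by apply: clx xV; exists f.
Qed.

(** Take [h] in the unit ball with value 1 at [y] and -1 at y'. Being related to both points forces
    the sum and the difference of [T one x] and [T h x] to have norm 2; strict convexity makes these
    unit vectors equal, and then the difference is 0. *)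
Lemma peak_rel_uniq x y y' : peak_rel (x, y) -> peak_rel (x, y') -> y = y'.
Proof.
move=> Gy Gy'; apply/eqP; apply: contrapT => /negP yy'.
have [U [V [yU y'V UV]]] := nbhs_disjoint L2 yy'.
have [e [ce e01 e0 /nbhs_singleton ey]] := bump R L2 hL yU.
have ey' : e y' = 0.
  apply: e0 => Uy'; have : (U `&` V) y' by split=> //; exact: nbhs_singleton.
  by rewrite UV.
pose e' : C := mkCont ce.
(* [half one h] and [half one (- h)] are [e'] and [1 - e']. *)
pose h : C := 2 *: e' - one.
have h1 z : `|h z| <= 1.
  have key (a : R) : 0 <= a <= 1 -> `|2 * a - 1| <= 1.
    by move=> /andP[? ?]; rewrite ler_norml; apply/andP; split; lra.
  exact/key/e01.
have one1 z : `|one z| <= 1 by rewrite [leLHS]normr1.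
have hy : h y = 1.
  have key (a : R) : a = 1 -> 2 * a - 1 = 1 by move=> ->; lra.
  exact: key ey.
have hy' : (- h) y' = 1.
  have key (a : R) : a = 0 -> - (2 * a - 1) = 1 by move=> ->; lra.
  exact: key ey'.
have T1 : `|T one x| = 1.
  by apply/eqP; rewrite eq_le Tx_le//= (Gy one).
have Th : `|T h x| = 1.
  by apply/eqP; rewrite eq_le Tx_le//= (Gy h).
have plus : 2 <= `|T one x + T h x|.
  by apply: norm_half; apply: Gy; exact: peak_half.
have minus : 2 <= `|T one x - T h x|.
  have : 2 <= `|T one x + T (- h) x|.
    apply: norm_half; apply: Gy'; apply: peak_half; split=> //= z.
    by rewrite [X in `|X|]/(- h z) normrN.
  by rewrite linearN.
have [Th1|Th1] := eqVneq (T one x) (T h x).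
  by move: minus; rewrite Th1 subrr normr0 leNgt ltr0n.
by have := Econv T1 Th Th1; rewrite ltNge plus.
Qed.

(** The function min (f + eps, 1) is within [eps] of [f] and peaks at every point near [y], so a
    related pair close to (x, y) gives a point near [x] where [T f] has norm at least 1 - eps. *)
Lemma peak_rel_closed : closed peak_rel.
Proof.
move=> [x y] cl f [f1 /= fy] /=; apply/ler_addgt0Pr => eps eps0.
rewrite -lerBlDr; apply: closed_norm_ge => V xV.
have cm : continuous ((fun z => f z + eps : R^o) \min (fun=> 1 : R^o)).
  move=> z; apply: continuous_min; last exact: cvg_cst.
  by apply: cvgD; [exact: Cont_continuous | exact: cvg_cst].
pose g : C := mkCont cm.
have key (a : R) : `|a| <= 1 -> 
    `|Num.min (a + eps) 1| <= 1 /\ `|Num.min (a + eps) 1 - a| <= eps.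
  rewrite ler_norml => /andP[? ?]; rewrite !ler_norml.
  by have [?|?] := leP (a + eps) 1; split; apply/andP; split; lra.
have g1 z : `|g z| <= 1 by case: (key _ (f1 z)).
have gf : `|g - f| <= eps.
  by apply: supnorm_le => [|z]; [exact: ltW | case: (key _ (f1 z))].
have yU : nbhs y [set z | g z = 1].
  have : nbhs y [set z | 1 - eps < (f z : R)].
    have fy1 : f z @[z --> y] --> (1 : R).
      by rewrite -fy; exact: Cont_continuous.
    have := fy1 [set t : R | 1 - eps < t]; apply.
    by apply: lt_nbhsr; rewrite gtrBl.
  apply: filterS => z fz.
  have key' (a : R) : 1 - eps < a -> Num.min (a + eps) 1 = 1.
    by rewrite ltrBlDr => ?; rewrite min_r// ltW.
  exact: key' fz.
have [[x' y'] [G' [/= Vx' gy']]] := cl _ (nbhs_setX xV yU).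
exists x'; split=> //=; have := G' g (conj g1 gy') => /=.
have -> : T g x' = T f x' + T (g - f) x'.
  by rewrite -[in LHS](subrK f g) linearD addrC.
move=> H; rewrite lerBlDr (le_trans H)// (le_trans (ler_normD _ _))// lerD2l.
by rewrite (le_trans (ler_supnorm _ _))// [leLHS]iT.
Qed.

Lemma strictly_convex_card_CBderiv a : CBderiv L a #<= CBderiv K a.
Proof.
exact: card_CBderiv_rel hK peak_rel_closed peak_rel_uniq peak_rel_surj a.
Qed.

End strictly_convex_isometry.

(** * Maps from zero-dimensional spaces *)

Section zero_dimensional_preimages.
Context {R : realType} {L : metricType R} {K : topologicalType}.
Hypotheses (hL : compact [set: L]) (hK : compact [set: K]).
Hypotheses (K2 : hausdorff_space K) (Kzd : clopen_based K).
Variable y0 : L.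
Implicit Types (A B : set L) (U V W : set K) (a : ord).

Lemma clopen_nbhs (x : K) U : nbhs x U -> exists V, [/\ clopen V, V x & V `<=` U].
Proof.
case: Kzd => B Bclopen [_ Bbasis] xU.
by have [V [BV Vx] VU] := Bbasis x U xU; exists V; split=> //; exact: Bclopen.
Qed.

(** The map is total but continuous only at points of [U], so that maps on disjoint open sets can be
    glued directly. *)
Definition maps_onto U A :=
  exists g : K -> L, (forall x, U x -> {for x, continuous g}) /\ g @` U = A.

Lemma continuous_at_near (f g : K -> L) x U : nbhs x U ->
  (forall z, U z -> f z = g z) -> {for x, continuous f} -> {for x, continuous g}.
Proof.
move=> xU fg cf; suff : g z @[z --> x] --> g x by [].
rewrite -(fg x (nbhs_singleton xU)).
by apply: cvg_trans cf; apply: near_eq_cvg; apply: filterS xU => z Uz; rewrite fg.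
Qed.

Lemma maps_onto0 : maps_onto set0 set0.
Proof. by exists (fun=> y0); split=> //; rewrite image_set0. Qed.

Lemma maps_ontoU U V A B : open U -> open V -> U `&` V = set0 ->
  maps_onto U A -> maps_onto V B -> maps_onto (U `|` V) (A `|` B).
Proof.
move=> oU oV UV [g [cg gU]] [h [ch hV]].
pose k x := if `[< U x >] then g x else h x.
have kU x : U x -> k x = g x by move=> Ux; rewrite /k asboolT.
have kV x : V x -> k x = h x.
  move=> Vx; rewrite /k asboolF// => Ux.
  by have : set0 x by rewrite -UV.
exists k; split=> [x [Ux|Vx]|].
- apply: (@continuous_at_near g k x U); last exact: cg.
    exact: open_nbhs_nbhs.
  by move=> z /kU.
- apply: (@continuous_at_near h k x V); last exact: ch.
    exact: open_nbhs_nbhs.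
  by move=> z /kV.
- rewrite image_setU -gU -hV; congr (_ `|` _); apply: eq_imagel => x.
    exact: kU.
  exact: kV.
Qed.

(** Since [W] misses [x], the rest of [U] is again a clopen neighbourhood of [x], in which further
    sets can be absorbed. *)
Definition absorbs a A := forall x U, CBderiv K a x -> clopen U -> U x ->
  exists W, [/\ clopen W, W `<=` U, ~ W x & maps_onto W A].

Lemma absorbs0 a : absorbs a set0.
Proof.
by move=> x U _ _ _; exists set0; split=> //; [exact: clopen0 | exact: maps_onto0].
Qed.

Lemma absorbsU a A B : absorbs a A -> absorbs a B -> absorbs a (A `|` B).
Proof.
move=> absA absB x U ax cU Ux.
have [W [cW WU nWx WA]] := absA x U ax cU Ux.
have cUW : clopen (U `\` W) by apply: clopenI => //; exact: clopenC.
have [V [cV VUW nVx VB]] := absB x _ ax cUW (conj Ux nWx).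
exists (W `|` V); split; first exact: clopenU.
- by move=> z [/WU//|/VUW[]].
- by case.
- apply: maps_ontoU => //; [by case: cW | by case: cV |].
  by apply/seteqP; split=> // z [Wz /VUW[]].
Qed.

Let d (q : L) (z : L) : R := mdist q z.

Let continuous_d q : continuous (d q).
Proof.
move=> z; apply/cvgrPdist_lt => e e0.
apply/nbhs_ballP; exists e => //= z'; rewrite ballEmdist/= => zz'.
have := metric_triangle q z z'; have := metric_triangle q z' z.
rewrite (metric_sym z' z) /d; rewrite ltr_norml => ? ?; apply/andP; split; lra.
Qed.

Let d_nbhs q (O : set L) : nbhs q O -> exists2 r, 0 < r & forall z, d q z < r -> O z.
Proof.
move=> /nbhs_ballP[r /= r0 rO]; exists r => // z qz; apply: rO.
by rewrite ballEmdist.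
Qed.

Lemma maps_onto_apex a A q z U :
  (forall B, closed B -> B `&` CBderiv L a = set0 -> absorbs a B) ->
  closed A -> A q -> A `&` CBderiv L a `<=` [set q] ->
  CBderiv K a z -> clopen U -> U z -> maps_onto U A.
Proof.
move=> IH cA Aq Aaq az cU Uz.
(* The annulus 1/(k+1) <= d <= 1/k, multiplied out so that [S 0] has no outer bound. *)
pose S k := A `&` [set y | k%:R * d q y <= 1 /\ 1 <= k.+1%:R * d q y].
have nSq k : ~ S k q.
  by move=> [_ /= [_]]; rewrite /d mdistxx mulr0 ler10.
have cS k : closed (S k).
  have cm (c : R) : continuous (fun y : L => c * d q y).
    by move=> y; apply: cvgM; [exact: cvg_cst | exact: continuous_d].
  apply: closedI => //; apply: closedI.
    by move/continuous_closedP : (cm k%:R) => /(_ _ (@closed_le _ 1)).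
  by move/continuous_closedP : (cm k.+1%:R) => /(_ _ (@closed_ge _ 1)).
have S0 k : S k `&` CBderiv L a = set0.
  apply/seteqP; split=> // y [Sy ay]; apply: (nSq k).
  by have <- : y = q by apply: Aaq; split=> //; case: Sy.
have /choice[st stP] (kV : nat * set K) : exists Wg : set K * (K -> L),
    clopen kV.2 -> kV.2 z -> [/\ clopen Wg.1, Wg.1 `<=` kV.2, ~ Wg.1 z,
      (forall x, Wg.1 x -> {for x, continuous Wg.2}) & Wg.2 @` Wg.1 = S kV.1].
  have [[cV Vz]|nV] := pselect (clopen kV.2 /\ kV.2 z); last first.
    by exists (set0, fun=> y0) => ? ?; case: nV.
  have [W [cW WV nWz [g [cg gW]]]] := IH _ (cS kV.1) (S0 kV.1) z kV.2 az cV Vz.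
  by exists (W, g).
(* What is left of [U] once the sets mapping onto the first [n] annuli are removed; it still
   contains [z]. *)
pose fix Vs n := if n is k.+1 then Vs k `\` (st (k, Vs k)).1 else U.
pose Ws n := (st (n, Vs n)).1; pose g n := (st (n, Vs n)).2.
have VsP n : clopen (Vs n) /\ Vs n z.
  elim: n => [//|n [cV Vz]] /=.
  have [cW _ nWz _ _] := stP (n, Vs n) cV Vz.
  by split=> //; apply: clopenI => //; exact: clopenC.
have WsP n : [/\ clopen (Ws n), Ws n `<=` Vs n, ~ Ws n z,
    (forall x, Ws n x -> {for x, continuous (g n)}) & g n @` Ws n = S n].
  by have [cV Vz] := VsP n; exact: stP.
have Vanti m n : (m <= n)%N -> Vs n `<=` Vs m.
  elim: n => [|n IHn]; first by rewrite leqn0 => /eqP ->.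
  rewrite leq_eqVlt => /predU1P[->//|]; rewrite ltnS => /IHn mn x [/mn].
  by [].
have WU n : Ws n `<=` U.
  by move=> x; have [_ WV _ _ _] := WsP n => /WV; exact: (@Vanti 0%N n).
have Wdisj m n x : (m < n)%N -> Ws m x -> Ws n x -> False.
  move=> mn Wm; have [_ WV _ _ _] := WsP n => /WV /(Vanti m.+1 n mn)[_].
  exact.
have Wuniq m n x : Ws m x -> Ws n x -> m = n.
  move=> Wm Wn; have [mn|nm|//] := ltngtP m n.
    by case: (Wdisj _ _ _ mn Wm Wn).
  by case: (Wdisj _ _ _ nm Wn Wm).
have /choice[G GP] (x : K) : exists y, (forall n, Ws n x -> y = g n x) /\
    ((forall n, ~ Ws n x) -> y = q).
  have [[n Wn]|nW] := pselect (exists n, Ws n x).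
    exists (g n x); split=> [m Wm|/(_ n)//].
    by rewrite (Wuniq _ _ _ Wm Wn).
  by exists q; split=> // n Wn; case: nW; exists n.
have GW n x : Ws n x -> G x = g n x by move=> Wn; have [H _] := GP x; exact: H.
have Gq x : (forall n, ~ Ws n x) -> G x = q by have [_] := GP x.
exists G; split=> [x Ux|].
  have [[n Wn]|nW] := pselect (exists n, Ws n x).
    have [[oW _] _ _ cg _] := WsP n.
    apply: (@continuous_at_near (g n) G x (Ws n)); last exact: cg.
      exact: open_nbhs_nbhs.
    by move=> t /GW.
  move=> O; rewrite /continuous_at Gq; last by move=> n Wn; apply: nW; exists n.
  move=> /d_nbhs[r r0 rO].
  (* The annuli of index at least [N] lie within [r] of [q], and [x] has a neighbourhood avoiding
     the finitely many earlier clopen sets; this gives continuity at [x]. *)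
  have [N Nr] : exists N : nat, r^-1 < N%:R.
    by exists (Num.truncn r^-1).+1; exact: truncnS_gt.
  have : \forall t \near x, forall k, (k < N)%N -> ~ Ws k t.
    elim: N {Nr} => [|N IHN]; first exact: filterE.
    have : \forall t \near x, ~ Ws N t.
      have [[_ cW] _ _ _ _] := WsP N.
      apply: open_nbhs_nbhs; split; first exact: closed_openC.
      by move=> Wx; apply: nW; exists N.
    move=> H; apply: filterS (filterI H IHN) => t [nWN IHt] k.
    by rewrite ltnS leq_eqVlt => /predU1P[->//|]; exact: IHt.
  apply: filterS => t tN; apply: rO.
  have [[n Wn]|nWt] := pselect (exists n, Ws n t); last first.
    rewrite Gq; first by rewrite /d mdistxx.
    by move=> n Wn; apply: nWt; exists n.
  have [_ _ _ _ gW] := WsP n.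
  have [_ /= [nd _]] : S n (g n t) by rewrite -gW; exists t.
  have Nn : (N <= n)%N by rewrite leqNgt; apply/negP => /tN.
  rewrite (GW n)// ltNge; apply/negP => rd.
  have : 1 < N%:R * r by rewrite -[ltLHS](mulVf (lt0r_neq0 r0)) ltr_pM2r.
  rewrite ltNge => /negP; apply; apply: le_trans nd.
  by apply: ler_pM => //; rewrite ?ler_nat// ltW.
apply/seteqP; split=> [_ [x Ux <-]|y Ay].
  have [[n Wn]|nW] := pselect (exists n, Ws n x).
    have [_ _ _ _ gW] := WsP n; rewrite (GW n)//.
    have [//] : S n (g n x) by rewrite -gW; exists x.
  by rewrite Gq// => n Wn; apply: nW; exists n.
have [->|yq] := eqVneq y q.
  by exists z => //; apply: Gq => n; have [_ _ nWz _ _] := WsP n.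
have dy : 0 < d q y by rewrite mdist_gt0 eq_sym.
(* Here n <= 1/d < n + 1, which places [y] in [S n]. *)
pose n := Num.truncn (d q y)^-1.
have dVy : 0 <= (d q y)^-1 by rewrite invr_ge0 ltW.
have Sy : S n y.
  have /andP[n1 n2] := truncn_itv dVy.
  split=> //=; split.
    by rewrite -[leRHS](mulVf (lt0r_neq0 dy)) ler_pM2r.
  by rewrite -[leLHS](mulVf (lt0r_neq0 dy)) ler_pM2r// ltW.
have [_ _ _ _ gW] := WsP n; move: Sy; rewrite -gW => -[x Wx gx].
by exists x; [exact: WU Wx | rewrite (GW n)].
Qed.

Let closed_nbhs (y : L) (O : set L) : nbhs y O ->
  exists X, [/\ closed X, nbhs y X & X `<=` O].
Proof.
move=> /(@uniform_regular L)[X yX XO]; exists (closure X).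
by split=> //; [exact: closed_closure | apply: filterS yX; exact: subset_closure].
Qed.

(** At a successor, compactness reduces [A] to closed pieces meeting [CBderiv L a] in at most one
    point; a point [x] of the next derivative of [K] has another point [z] of [CBderiv K a] in [U],
    and [maps_onto_apex] applies in a clopen neighbourhood of [z] missing [x]. At a supremum,
    compactness makes [A] miss an earlier derivative or be empty. *)
Lemma absorbs_of_disjoint a A : closed A -> A `&` CBderiv L a = set0 -> absorbs a A.
Proof.
elim: a A => [|a IH|I f IH] A cA A0.
- by have -> : A = set0; [rewrite -A0 /= setIT | exact: absorbs0].
- have coA : compact A by exact: subclosed_compact cA hL _.
  apply: (compact_ind (P := absorbs (osucc a)) coA (@absorbs0 _)) => [B C|y Ay].
    exact: absorbsU.
  have [O yO Oa] : exists2 O, nbhs y O & CBderiv L a `&` O `<=` [set y].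
    have [ay|nay] := pselect (CBderiv L a y); last first.
      exists (~` CBderiv L a); last by move=> z [].
      apply: open_nbhs_nbhs; split=> //; apply: closed_openC; exact: CBderiv_closed.
    have : ~ limit_point (CBderiv L a) y.
      by move=> ly; have : set0 y by rewrite -A0.
    by rewrite not_limit_pointE.
  have [X [cX yX XO]] := closed_nbhs yO; exists X => // x U [ax lx] cU Ux.
  have [z [zx az Uz]] : exists z, [/\ z != x, CBderiv K a z & U z].
    by apply: lx; apply: open_nbhs_nbhs; case: cU.
  have zU : nbhs z (U `\ x).
    apply: open_nbhs_nbhs; split; last by split=> //; apply/eqP.
    apply: openI; first by case: cU.
    by apply: closed_openC; exact/accessible_closed_set1/hausdorff_accessible.
  have [V [cV Vz VU]] := clopen_nbhs zU.
  exists V; split=> //.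
  + by move=> t /VU[].
  + by move=> /VU[_]; exact.
  + apply: (maps_onto_apex (q := y)) (Vz) => //.
    * exact: IH.
    * exact: closedI.
    * by split=> //; exact: nbhs_singleton.
    * by move=> t [[At Xt] at']; apply: Oa; split=> //; exact: XO.
    * exact: az.
- have [[i Ai]|nA] := pselect (exists i, A `&` CBderiv L (f i) = set0).
    by move=> x U ax; apply: (IH i).
  rewrite (_ : A = set0); first exact: absorbs0.
  have [[i0 _]|nI] := pselect (exists i : I, True); last first.
    rewrite -A0; apply/seteqP; split=> [y Ay|y []//]; split=> // i.
    by case: nI; exists i.
  have coA : compact A by exact: subclosed_compact cA hL _.
  have [|y Hy] := compact_CBderiv_sup (f := f) i0 coA cA; last by rewrite A0 in Hy.
  by move=> i; apply/set0P/eqP => Ai; apply: nA; exists i.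
Qed.

(** Each point of [A] in the derivative is made the apex over its own point of [t]. A neighbourhood
    of the apex and a clopen neighbourhood of that point are split off, both missing the other
    listed points. *)
Lemma maps_onto_seq a (y : L) (s : seq L) (t : seq K) A U :
  uniq (y :: s) -> uniq t -> (size (y :: s) <= size t)%N ->
  closed A -> A `&` CBderiv L a `<=` [set` y :: s] -> [set` y :: s] `<=` A ->
  clopen U -> [set` t] `<=` U `&` CBderiv K a -> maps_onto U A.
Proof.
elim: s y t A U => [|y' s IH] y [//|z t] A U us ut st cA As sA cU tU.
  apply: (maps_onto_apex (a := a) (q := y) (z := z)) => //.
  - exact: absorbs_of_disjoint.
  - by apply: sA; rewrite /= inE.
  - by move=> x /As /=; rewrite inE => /eqP.
  - by have [] := tU z; rewrite /= ?inE ?eqxx.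
  - by have [] := tU z; rewrite /= ?inE ?eqxx.
have [[Uz az] [yns us'] [znt ut']] : [/\ (U `&` CBderiv K a) z,
    y \notin y' :: s /\ uniq (y' :: s) & z \notin t /\ uniq t].
  split; first by apply: tU; exact: mem_head.
    by apply/andP; move: us; rewrite cons_uniq.
  by apply/andP; move: ut; rewrite cons_uniq.
have ys : nbhs y (~` [set` y' :: s]).
  apply: open_nbhs_nbhs; split; last exact/negP.
  apply: closed_openC; apply: (iffLR accessible_finite_set_closed) (finite_seq _).
  exact/hausdorff_accessible/metric_hausdorff.
have [X [cX yX Xs]] := closed_nbhs ys.
have zt : nbhs z (U `&` ~` [set` t]).
  apply: open_nbhs_nbhs; split; last by split=> //; exact/negP.
  apply: openI; first by case: cU.
  apply: closed_openC; apply: (iffLR accessible_finite_set_closed) (finite_seq _).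
  exact: hausdorff_accessible.
have [V [cV Vz VU]] := clopen_nbhs zt.
(* Removing only the interior of [X] keeps both pieces closed; they may overlap. *)
have -> : A = (A `&` X) `|` (A `&` ~` X^°).
  rewrite -setIUr (_ : X `|` _ = setT) ?setIT//.
  apply/seteqP; split=> // x _; have [Xx|nXx] := pselect (X x); first by left.
  by right=> /nbhs_singleton.
have -> : U = V `|` (U `&` ~` V).
  apply/seteqP; split=> [x Ux|x [/VU[]|[]]//].
  by have [Vx|nVx] := pselect (V x); [left | right].
have cUV : clopen (U `&` ~` V) by apply: clopenI => //; exact: clopenC.
apply: maps_ontoU => //; [by case: cV | by case: cUV | | |].
- by apply/seteqP; split=> // x [Vx []].
- apply: (maps_onto_apex (a := a) (q := y)) (Vz) => //.
  + exact: absorbs_of_disjoint.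
  + exact: closedI.
  + by split; [apply: sA; exact: mem_head | exact: nbhs_singleton].
  + move=> x [[Ax Xx] ax]; have /As : (A `&` CBderiv L a) x by [].
    by rewrite /= inE => /predU1P[//|xs]; case: (Xs x Xx).
- apply: (IH y' t) => //.
  + by apply: closedI => //; apply: open_closedC; exact: open_interior.
  + move=> x [[Ax nXx] ax]; have /As : (A `&` CBderiv L a) x by [].
    by rewrite /= inE => /predU1P[xy|//]; case: nXx; rewrite xy.
  + move=> x xs; split; first by apply: sA; rewrite /= inE xs orbT.
    by move=> /nbhs_singleton /Xs; apply.
  + move=> x xt; have [Ux ax] : (U `&` CBderiv K a) x.
      by apply: tU; rewrite /= inE [X in _ || X]xt orbT.
    by split=> //; split=> // /VU[_]; exact.
Qed.

Lemma scattered_maps_onto : scattered L ->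
  (forall a, is_height L (osucc a) -> CBderiv L a #<= CBderiv K a) ->
  exists g : K -> L, continuous g /\ range g = [set: L].
Proof.
move=> /scatteredP[c Lc] LK.
have L0 : [set: L] !=set0 by exists y0.
have [a La La0] := height_succ hL L0 Lc.
have fLa : finite_set (CBderiv L a).
  rewrite -[CBderiv L a]setTI; apply: (finite_CBderiv hL (@closedT L)).
  by rewrite setTI; case: La.
(* [C] is a set of points of [CBderiv K a], as many as in the finite set [CBderiv L a], to serve as
   the list [t] of [maps_onto_seq]. *)
have /card_subP[C /card_eqPle[CL LC] CK] := LK a La.
have fC := card_le_finite CL fLa.
have [n /card_eqPle[Ln nL]] := fLa.
have sn := geq_card_fset_set Ln.
have tn := leq_card_fset_set fC (card_le_trans nL LC).
have ut := finmap.fset_uniq (fset_set C).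
have us := finmap.fset_uniq (fset_set (CBderiv L a)).
have sE x : x \in finmap.enum_fset (fset_set (CBderiv L a)) <-> CBderiv L a x.
  by rewrite in_fset_set// inE.
have tE x : x \in finmap.enum_fset (fset_set C) <-> C x.
  by rewrite in_fset_set// inE.
move: sn tn ut us sE tE.
case: (finmap.enum_fset _) => [|y s]; case: La0 => x0 ax0.
  by move=> _ _ _ _ /(_ x0)[_ /(_ ax0)].
move: (finmap.enum_fset _) => t sn tn ut us sE tE.
have [g [cg gT]] : maps_onto setT setT.
  apply: (maps_onto_seq (a := a) us ut (leq_trans sn tn)) => //.
  - by move=> x [_] /sE.
  - exact: clopenT.
  - by move=> x /tE /CK.
exists g; split=> // x; exact: cg.
Qed.

End zero_dimensional_preimages.

(** * Maps onto and from the Cantor space *)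

Lemma continuous_cantor (S : topologicalType) (D : nat -> set S) :
  (forall n, clopen (D n)) ->
  continuous ((fun x n => `[< D n x >]) : S -> cantor_space).
Proof.
move=> cD x; apply/cvg_sup => n A [_ [[B oB <-] /= Bx] BA].
have [Dx|nDx] := pselect (D n x).
  have : nbhs x (D n) by apply: open_nbhs_nbhs; case: (cD n).
  apply: filterS => z Dz; apply: BA; rewrite /= /proj.
  by move: Bx; rewrite /proj !asboolT.
have : nbhs x (~` D n).
  by apply: open_nbhs_nbhs; split=> //; apply: closed_openC; case: (cD n).
apply: filterS => z nDz; apply: BA; rewrite /= /proj.
by move: Bx; rewrite /proj !asboolF.
Qed.

(** [L] is given the base point [y0] in order to apply [cantor_surj]. *)
Lemma metric_cantor_surj (R : realType) (L : metricType R) (y0 : L) :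
  compact [set: L] ->
  exists f : cantor_space -> L, continuous f /\ range f = [set: L].
Proof.
move=> hL; pose Lp : pseudoPMetricType R := HB.pack_for (pseudoPMetricType R)
  (L : Type) (isPointed.Build L y0) (PseudoMetric.class L).
have [f cf] := @cantor_surj R Lp hL (@metric_hausdorff R L).
exists f; split=> //; apply/seteqP; split=> // y _.
by have [x _ <-] := 'surj_f (Logic.I : setT (y : Lp)); exists x.
Qed.

Section perfect_cantor.
Context {K : topologicalType} (P : set K).
Hypotheses (hK : compact [set: K]) (K2 : hausdorff_space K).
Hypotheses (Kzd : clopen_based K).
Hypotheses (clP : closed P) (P0 : P !=set0) (Plim : P `<=` limit_point P).

Let meets (U : set K) := clopen U /\ U `&` P !=set0.

Let splits : exists c : set K -> set K, forall U, meets U ->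
  meets (U `&` c U) /\ meets (U `\` c U).
Proof.
suff /choice[c cP] U : exists V, meets U -> meets (U `&` V) /\ meets (U `\` V).
  by exists c.
have [[cU [x [Ux Px]]]|nU] := pselect (meets U); last by exists set0.
have xU : nbhs x U by apply: open_nbhs_nbhs; case: cU.
have [z [zx Pz Uz]] := Plim Px xU.
have [V [W [zV xW VW]]] := nbhs_disjoint K2 zx.
have [V' [cV' V'z V'V]] := clopen_nbhs Kzd zV.
exists V' => _; split; split.
- exact: clopenI.
- by exists z.
- by apply: clopenI => //; exact: clopenC.
- exists x; split=> //; split=> // /V'V Vx.
  by have : set0 x by rewrite -VW; split=> //; exact: nbhs_singleton.
Qed.

(** Splitting repeatedly gives a binary tree of clopen sets [A s] that all meet [P]. A point goes to
    the branch it follows; its address of length [n] is constant on a clopen set, whence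
    continuity. *)
Lemma perfect_maps_onto_cantor :
  exists g : K -> cantor_space, continuous g /\ range g = [set: cantor_space].
Proof.
have [c cP] := splits.
pose fix A (s : seq bool) : set K :=
  if s is b :: s' then (if b then A s' `&` c (A s') else A s' `\` c (A s')) else setT.
have AP s : meets (A s).
  elim: s => [|b s /cP[IH1 IH2]] /=; last by case: b.
  split; first exact: clopenT.
  by have [x Px] := P0; exists x.
(* Addresses list the latest choice first. *)
pose fix addr x n : seq bool :=
  if n is k.+1 then `[< c (A (addr x k)) x >] :: addr x k else [::].
have Aaddr x n : A (addr x n) x.
  elim: n => [//|n IH] /=.
  have [cx|ncx] := pselect (c (A (addr x n)) x).
    by rewrite asboolT.
  by rewrite asboolF.
have addr_eq z x n : A (addr x n) z -> addr z n = addr x n.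
  elim: n => [//|n IH] /=.
  have [cx|ncx] := pselect (c (A (addr x n)) x).
    rewrite (asboolT cx) => -[Az cz]; rewrite (IH Az); congr (_ :: _).
    exact: asboolT.
  rewrite (asboolF ncx) => -[Az cz]; rewrite (IH Az); congr (_ :: _).
  exact: asboolF.
pose D n : set K := [set x | c (A (addr x n)) x].
have cD n : clopen (D n).
  have op (b : bool) : open [set x | `[< D n x >] = b].
    rewrite openE => x /= Dx; have [[oA _] _] := AP (addr x n.+1).
    have : nbhs x (A (addr x n.+1)) by apply: open_nbhs_nbhs; split.
    rewrite /interior; apply: filterS => z /addr_eq /= [zx _].
    by rewrite -Dx; exact: zx.
  split; first by rewrite (_ : D n = [set x | `[< D n x >] = true]) //;
    apply/seteqP; split=> x; [move/asboolT | move/asboolP].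
  rewrite -openC (_ : ~` D n = [set x | `[< D n x >] = false])//.
  by apply/seteqP; split=> x /=; [move/asboolF | move=> + Dx; rewrite asboolT].
exists (fun x n => `[< D n x >]); split; first exact: continuous_cantor.
apply/seteqP; split=> // beta _.
(* The clopen sets along the branch [beta] are nested and nonempty; by compactness some point lies
   in all of them, and its branch is [beta]. *)
pose fix pre n : seq bool := if n is k.+1 then beta k :: pre k else [::].
have Apre m n : (m <= n)%N -> A (pre n) `<=` A (pre m).
  elim: n => [|n IH]; first by rewrite leqn0 => /eqP ->.
  rewrite leq_eqVlt => /predU1P[->//|]; rewrite ltnS => /IH mn x /=.
  by case: (beta n) => -[/mn].
pose F := [set B | exists n, A (pre n) `<=` B].
have FF : ProperFilter F.
  split; first by move=> [n An]; have [_ [x [/An]]] := AP (pre n).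
  split; first by exists 0%N.
  - move=> B C [m mB] [n nC]; exists (maxn m n) => x Ax.
    by split; [apply/mB/(Apre m _ (leq_maxl m n)) | apply/nC/(Apre n _ (leq_maxr m n))].
  - by move=> B C BC [n nB]; exists n; exact: subset_trans nB BC.
have [x [_ clx]] := hK FF (@filterT _ F _).
have Ax n : A (pre n) x.
  have [[_ clA] _] := AP (pre n); apply: clA => V xV.
  by apply: clx xV; exists n.
have addr_pre n : addr x n = pre n.
  elim: n => [//|n IH] /=; rewrite IH; congr (_ :: _).
  have := Ax n.+1 => /=.
  by case: (beta n) => -[_ cx]; [exact: asboolT | exact: asboolF].
exists x => //; apply/funext => n.
by have := addr_pre n.+1 => /= -[].
Qed.

End perfect_cantor.

Lemma zero_dimensional_maps_onto (R : realType) (L : metricType R)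
    (K : topologicalType) :
  compact [set: L] -> [set: L] !=set0 -> compact [set: K] ->
  hausdorff_space K -> clopen_based K ->
  (~ scattered L -> ~ scattered K) ->
  (scattered L ->
     forall a, is_height L (osucc a) -> CBderiv L a #<= CBderiv K a) ->
  exists g : K -> L, continuous g /\ range g = [set: L].
Proof.
move=> hL [y0 _] hK K2 Kzd LKn LKs.
have [sL|nL] := pselect (scattered L).
  exact: (scattered_maps_onto hL K2 Kzd y0 sL (LKs sL)).
have [P PK] := @perfect_kernel_ex K; have [c cP] := PK.
have PE : CBderiv K c = P by apply: cP; exact: ole_refl.
have clP : closed P by rewrite -PE; exact: CBderiv_closed.
(* The derivative following stage [c] is still [P]. Should [ole_total] yield its other alternative,
   stage [c] already lies in a later derivative. *)
have Plim : P `<=` limit_point P.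
  have [cSc|Scc] := ole_total c (osucc c).
    by have := cP _ cSc; rewrite /= PE => {1}<- x [].
  rewrite -PE => x /(CBderiv_anti Scc)[[_ lx] _]; exact: lx.
have P0 : P !=set0.
  by apply/set0P; apply/eqP => P0; apply: (LKn nL); rewrite P0 in PK.
have [g [cg gT]] := perfect_maps_onto_cantor hK K2 Kzd P0 Plim.
have [f [cf fT]] := metric_cantor_surj y0 hL.
exists (f \o g); split.
  by move=> x; apply: continuous_comp; [exact: cg | exact: cf].
apply/seteqP; split=> // y _; have [u _ <-] : range f y by rewrite fT.
by have [x _ <-] : range g u; [rewrite gT | exists x].
Qed.

(** * Composition operators *)

Section composition.
Context {R : realType} {L K : topologicalType}.
Context {hL : compact [set: L]} {hK : compact [set: K]}.
Context {E : normedModType R} (g : K -> L) (cg : continuous g) (v : E).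

Fact comp_scale_cont (f : Cont hL R) : continuous (fun x => (f (g x) : R) *: v).
Proof.
move=> x; apply: cvgZl; apply: (@continuous_comp K L R g f); first exact: cg.
exact: Cont_continuous.
Qed.

Definition comp_scale (f : Cont hL R) : Cont hK E := mkCont (@comp_scale_cont f).

Fact comp_scale_linear : linear comp_scale.
Proof.
move=> k f h; apply: ContP => x; have key (a b : R) :
    (k * a + b) *: v = k *: (a *: v) + b *: v by rewrite scalerDl scalerA.
exact: key.
Qed.

HB.instance Definition _ :=
  GRing.isLinear.Build R (Cont hL R) (Cont hK E) *:%R comp_scale comp_scale_linear.

Lemma comp_scale_isometric : range g = [set: L] -> `|v| = 1 -> isometric comp_scale.
Proof.
move=> gT v1 f; have key x : `|comp_scale f x| = `|f (g x)|.
  by rewrite [LHS]normrZ v1 mulr1.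
apply/eqP; rewrite eq_le; apply/andP; split; apply: supnorm_le => // z.
  by rewrite key ler_supnorm.
have [x _ <-] : range g z by rewrite gT.
by rewrite -key ler_supnorm.
Qed.

End composition.

Theorem theorem4p2 (R : realType)
  (L : metricType R) (hL : compact [set: L]) (L0 : [set: L] !=set0)
  (K : topologicalType) (hK : compact [set: K]) (K0 : [set: K] !=set0)
  (K2 : hausdorff_space K) (Kzd : clopen_based K) :
  [<-> (* i *)
       exists T : {linear Cont hL R -> Cont hK R}, isometric T;
       (* ii *)
       exists F : set K, closed F /\
         exists g : K -> L, {within F, continuous g} /\ g @` F = [set: L];
       (* iii *)
       forall a : ord, CBderiv L a #<= CBderiv K a;
       (* iv *)
       (~ scattered L -> ~ scattered K) /\
       (scattered L ->
         forall a : ord, is_height L (osucc a) -> CBderiv L a #<= CBderiv K a);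
       (* v *)
       exists T : {linear Cont hL R -> Cont hK R},
         isometric T /\
         forall f : Cont hL R, (forall y, 0 <= f y) -> forall x, 0 <= T f x;
       (* vi *)
       exists (T : {linear Cont hL R -> Cont hK R})
              (Tinv : Cont hK R -> Cont hL R),
         [/\ bounded_on setT T, cancel T Tinv, bounded_on (range T) Tinv &
             opnorm setT T * opnorm (range T) Tinv < 3];
       (* vii *)
       forall E : completeNormedModType R, (exists u : E, u != 0) ->
         exists T : {linear Cont hL R -> Cont hK E}, isometric T;
       (* viii *)
       exists E : completeNormedModType R,
         [/\ exists u : E, u != 0, strictly_convex E &
             exists T : {linear Cont hL R -> Cont hK E}, isometric T];
       (* ix *)
       exists g : K -> L, continuous g /\ range g = [set: L];
       (* x *)
       exists T : {linear Cont hL R -> Cont hK R},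
         [/\ isometric T,
             {morph T : f g / Cont_max f g},
             {morph T : f g / Cont_min f g} &
             {morph T : f g / Cont_mul f g}]].
Proof.
have L2 : hausdorff_space L := @metric_hausdorff R L.
pose i := exists T : {linear Cont hL R -> Cont hK R}, isometric T.
pose iii := forall a : ord, CBderiv L a #<= CBderiv K a.
pose iv := (~ scattered L -> ~ scattered K) /\
  (scattered L ->
    forall a : ord, is_height L (osucc a) -> CBderiv L a #<= CBderiv K a).
pose vi := exists (T : {linear Cont hL R -> Cont hK R})
    (Tinv : Cont hK R -> Cont hL R),
  [/\ bounded_on setT T, cancel T Tinv, bounded_on (range T) Tinv &
      opnorm setT T * opnorm (range T) Tinv < 3].
pose ix := exists g : K -> L, continuous g /\ range g = [set: L].
(* The equivalences pass through i -> vi -> iv -> ix; a surjection [g] as in ix then yields every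
   embedding by composition. *)
have iv_ix : iv -> ix by move=> [LKn LKs]; exact: zero_dimensional_maps_onto.
have iii_iv : iii -> iv by exact: card_CBderiv_scattered.
have vi_iv : vi -> iv.
  by move=> [T [Tinv [bT TK bTinv T3]]]; exact: embedding_CBderiv bT TK bTinv T3.
have i_vi : i -> vi.
  move=> [T /isometric_embedding[Tinv [bT TK bTinv T1]]].
  by exists T, Tinv; split=> //; apply: le_lt_trans T1 _; rewrite ltr1n.
have ix_comp (E : normedModType R) (v : E) : ix -> `|v| = 1 ->
    exists2 T : {linear Cont hL R -> Cont hK E}, isometric T &
      exists g : K -> L, forall f x, T f x = (f (g x) : R) *: v.
  move=> [g [cg gT]] v1; exists (comp_scale cg v); first exact: comp_scale_isometric.
  by exists g.
have ix_R : ix -> exists2 T : {linear Cont hL R -> Cont hK R}, isometric T &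
    exists g : K -> L, forall f x, T f x = f (g x).
  move=> /(ix_comp R 1)[|T iT [g Tg]]; first exact: normr1.
  by exists T => //; exists g => f x; rewrite Tg [LHS]mulr1.
tfae.
- move=> /i_vi/vi_iv/iv_ix[g [cg gT]]; exists setT; split; first exact: closedT.
  by exists g; split=> //; exact: continuous_subspaceT.
- by move=> [F [clF [g [cg gF]]]]; exact: closed_image_card_CBderiv cg gF.
- exact: iii_iv.
- move=> /iv_ix/ix_R[T iT [g Tg]]; exists T; split=> // f f0 x.
  by rewrite Tg.
- by move=> [T [iT _]]; apply: i_vi; exists T.
- move=> /vi_iv/iv_ix Hix E [u u0].
  have [|T iT _] := ix_comp E (`|u|^-1 *: u) Hix; last by exists T.
  by rewrite normrZ normfV normr_id mulVf// normr_eq0.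
- move=> H; exists R; split; first by exists 1; exact: oner_neq0.
    (* Distinct reals of absolute value 1 are opposite, so [R] itself is strictly convex. *)
    move=> u v u1 v1 uv; have key (a b : R) :
        `|a| = 1 -> `|b| = 1 -> a != b -> `|a + b| < 2.
      move=> a1 b1 ab; have /eqP : `|a| = `|b| by rewrite a1 b1.
      by rewrite eqr_norm2 (negbTE ab)/= => /eqP ->; rewrite addNr normr0.
    exact: key.
  by apply: H; exists 1; exact: oner_neq0.
- move=> [E [_ Econv [T iT]]]; apply/iv_ix/iii_iv => a.
  exact: (strictly_convex_card_CBderiv L2 K0 Econv iT).
- move=> /ix_R[T iT [g Tg]]; exists T; split=> // f h; apply: ContP => x.
  + by rewrite Tg [RHS]/(Num.max (T f x) (T h x)) !Tg.
  + by rewrite Tg [RHS]/(Num.min (T f x) (T h x)) !Tg.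
  + by rewrite Tg [RHS]/(T f x * T h x) !Tg.
- by move=> [T [iT _ _ _]]; exists T.
Qed.
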